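(* Let $K$ be an infinite field and let $\Gamma$ be a $(d-1)$-dimensional strongly edge decomposable complex on $[n]$. Then $\Delta^e(\Gamma)\subset\Delta(n,d)$.
   Context: Simplicial complex on $[n]$: subsets containing all singletons, closed under subsets; pure: all maximal faces of equal size. $\mathrm{lk}_\Gamma(F)=\{G\subset[n]\setminus F:G\cup F\in\Gamma\}$, $\mathrm{lk}_\Gamma(v)=\mathrm{lk}_\Gamma(\{v\})$, $\mathcal C_\Gamma(i,j)=\{F\in\Gamma:i\notin F\}\cup\{(F\setminus\{i\})\cup\{j\}:i\in F\in\Gamma\}$ for $i<j$; Link condition w.r.t. $\{i,j\}$: $\mathrm{lk}_\Gamma(i)\cap\mathrm{lk}_\Gamma(j)=\mathrm{lk}_\Gamma(\{i,j\})$. Strongly edge decomposable (recursive): boundaries of simplices and $\{\emptyset\}$ are; a pure $\Gamma$ is if for some $\{i,j\}\in\Gamma$, $\Gamma$ satisfies the Link condition w.r.t. $\{i,j\}$ and $\mathcal C_\Gamma(i,j)$, $\mathrm{lk}_\Gamma(\{i,j\})$ are strongly edge decomposable. $\Delta^e(\Gamma)$: exterior algebraic shifting over $K$, i.e. the complex on $[n]$ whose exterior face ideal is $\mathrm{Gin}(J_\Gamma)$, where $J_\Gamma\subset\bigwedge\langle e_1,\dots,e_n\rangle$ is generated by $e_F$ ($F\notin\Gamma$) and $\mathrm{Gin}$ is the generic initial ideal w.r.t. the reverse lexicographic order induced by $1>\dots>n$. $\Delta(n,d)$: the complex generated by all $d$-subsets $F\subset[n]$ such that for every integer $k\ge0$,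 $n-k\notin F$ implies $\{n-d+k,\dots,n-k-1\}\subset F$ (this equals the symmetric shifting of the boundary of the cyclic $d$-polytope with $n$ vertices). *)

(* Defs.v *)
From mathcomp Require Import all_boot all_order all_algebra.
From mathcomp Require Import boolp classical_sets cardinality.
From mathcomp Require mpoly.

Set Implicit Arguments.
Unset Strict Implicit.
Unset Printing Implicit Defensive.

Import Order.TTheory GRing.Theory Num.Theory.

(* The vertex set [n] = {1, ..., n} is represented by 'I_n: the ordinal i      *)
(* stands for the vertex i.+1.                                                 *)

Section Complexes.
Variable n : nat.
Implicit Types (C : {set {set 'I_n}}) (F G V : {set 'I_n}) (i j v : 'I_n).

(* A complex whose vertices form some subset of [n]; contractions and links    *)
(* of a complex on [n] are of this kind.                                       *)
Definition subset_closed C : Prop :=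
  finset.set0 \in C /\ forall F G, F \in C -> G \subset F -> G \in C.

Definition simplicial_complex C : Prop :=
  subset_closed C /\ forall v, [set v] \in C.

Definition facet C F : bool := maxset (fun G => G \in C) F.

Definition pure C : Prop := forall F G, facet C F -> facet C G -> #|F| = #|G|.

(* dim C + 1 *)
Definition dimS C : nat := \max_(F in C) #|F|.

Definition link C F : {set {set 'I_n}} :=
  [set G : {set 'I_n} | [disjoint G & F] & G :|: F \in C].

Definition contraction C i j : {set {set 'I_n}} :=
  [set F in C | i \notin F] :|: [set j |: (F :\ i) | F in C & i \in F].

Definition link_condition C i j : Prop :=
  link C [set i] :&: link C [set j] = link C [set i; j].

Definition simplex_boundary V : {set {set 'I_n}} := [set F : {set 'I_n} | F \proper V].

Inductive strongly_edge_decomposable : {set {set 'I_n}} -> Prop :=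
| sed_empty : strongly_edge_decomposable [set finset.set0]
| sed_simplex_boundary V :
    V != finset.set0 -> strongly_edge_decomposable (simplex_boundary V)
| sed_contract C i j :
    subset_closed C -> pure C ->
    (i < j)%N -> [set i; j] \in C -> link_condition C i j ->
    strongly_edge_decomposable (contraction C i j) ->
    strongly_edge_decomposable (link C [set i; j]) ->
    strongly_edge_decomposable C.

End Complexes.

Local Open Scope ring_scope.

Section ExteriorAlgebra.
Variables (K : fieldType) (n : nat).

(* The exterior algebra on e_1, ..., e_n: u F is the coefficient of            *)
(* e_F = e_{i_1} /\ ... /\ e_{i_k}, where F = {i_1 < ... < i_k}.               *)
Local Notation ext := {ffun {set 'I_n} -> K}.

Implicit Types (F G H : {set 'I_n}) (u v : ext) (phi : 'M[K]_n).

Definition ext_monomial F : ext := [ffun G => (G == F)%:R].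

(* e_F /\ e_G = ext_sign F G * e_(F :|: G) for disjoint F and G *)
Definition ext_sign F G : K :=
  (-1) ^+ #|[set p : 'I_n * 'I_n | [&& p.1 \in F, p.2 \in G & (p.2 < p.1)%N]]|.

Definition ext_mul u v : ext :=
  [ffun H : {set 'I_n} =>
     \sum_(F : {set 'I_n} | F \subset H)
        ext_sign F (H :\: F) * (u F * v (H :\: F))].

(* phi maps e_i to \sum_j phi j i * e_j *)
Definition ext_gen_image phi (i : 'I_n) : ext :=
  [ffun G => \sum_(j < n) phi j i * ext_monomial [set j] G].

(* enum F lists F in increasing order *)
Definition ext_monomial_image phi F : ext :=
  \big[ext_mul/ext_monomial finset.set0]_(i <- enum F) ext_gen_image phi i.

Definition ext_map phi u : ext :=
  [ffun G => \sum_(F : {set 'I_n}) u F * ext_monomial_image phi F G].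

(* F <_rev G, for the graded reverse lexicographic order with e_1 > ... > e_n *)
Definition revlex_lt F G : Prop :=
  (#|F| < #|G|)%N \/
  #|F| = #|G| /\
  exists i : 'I_n, [/\ i \in F, i \notin G &
    forall j : 'I_n, (i < j)%N -> (j \in F) = (j \in G)].

Definition is_initial u F : Prop :=
  u F != 0 /\ forall G, u G != 0 -> G = F \/ revlex_lt G F.

Local Open Scope classical_set_scope.

Definition is_ideal (I : set ext) : Prop :=
  [/\ I 0,
      forall u v, I u -> I v -> I (u + v) &
      forall u v, I v -> I (ext_mul u v) /\ I (ext_mul v u)].

Definition ideal_gen (S : set ext) : set ext :=
  [set u | forall I : set ext, is_ideal I -> S `<=` I -> I u].

Definition initial_ideal (J : set ext) : set ext :=
  ideal_gen [set w | exists u F, [/\ J u, is_initial u F & w = ext_monomial F]].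

Definition zariski_open_GL (U : set 'M[K]_n) : Prop :=
  exists S : set (mpoly.mpoly (n * n) K),
    U = [set phi | phi \in unitmx /\
           exists2 p, S p & mpoly.meval (fun k => mxvec phi 0 k) p != 0].

Definition is_gin (J I : set ext) : Prop :=
  exists U : set 'M[K]_n, [/\ zariski_open_GL U, U !=set0 &
    forall phi, U phi -> initial_ideal (ext_map phi @` J) = I].

(* For an infinite field K and a graded ideal J there is exactly one I with    *)
(* is_gin J I; the default value is irrelevant then.                           *)
Definition gin (J : set ext) : set ext := xget set0 [set I | is_gin J I].

Definition face_ideal (C : {set {set 'I_n}}) : set ext :=
  ideal_gen [set w | exists2 F, F \notin C & w = ext_monomial F].

(* A complex C is recovered from its exterior face ideal as the set of all F   *)
(* such that e_F is not in the ideal.                                          *)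
Definition exterior_shifting (C : {set {set 'I_n}}) : set {set 'I_n} :=
  [set F | ~ gin (face_ideal C) (ext_monomial F)].

End ExteriorAlgebra.

Arguments exterior_shifting K {n} C _.

(* The integer m, as a vertex label in {1, ..., n}, belongs to F. *)
Definition label_in (n : nat) (F : {set 'I_n}) (m : int) : Prop :=
  exists2 i : 'I_n, i \in F & m = i.+1%:Z.

Definition cyclic_facet (n d : nat) (F : {set 'I_n}) : Prop :=
  #|F| = d /\
  forall k : nat, ~ label_in F (n%:Z - k%:Z) ->
    forall m : int, n%:Z - d%:Z + k%:Z <= m <= n%:Z - k%:Z - 1 -> label_in F m.

Definition cyclic_shifting (n d : nat) : set {set 'I_n} :=
  fun G => exists2 F, cyclic_facet d F & G \subset F.
Arguments cyclic_shifting : clear implicits.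

(* Main.v *)
(* Let y_0, y_1, ... be generic linear forms, y_l playing the role of e_(n-l), and
   write K{C} for the exterior face ring of a (d-1)-dimensional complex C.
   Reverse lexicographic initial monomials are controlled by the ranks
     r_m(s) = dim (y_0 ... y_(m-1) K{C})_s  and
     c_k    = dim (y_0 ... y_(k-1) (y_k, y_(k+1) ... y_(d-k)) K{C})_d, 2k < d.
   Let i, j be an edge satisfying the Link condition, D the contraction and L the
   link.  Pulling back along the simplicial map i |-> j embeds K{D} into K{C},
   and taking the coefficients of e_i e_j kills this image and reduces to K{L}
   once y_0 is specialised to e_j.  Hence the ranks of C are at least the sum of
   those of D (same m, s, k) and of L (with m - 1, s - 2, k - 1).  Since the face
   numbers satisfy f_C(t) = f_D(t) + t (1 + t) f_L(t), induction gives
   r_m(s) >= rho_m(s) for s <= d and c_k >= rho_k(d), where rho_m(s) is the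
   coefficient of t^s in t^m / (1 + t)^m f_C(t); boundaries of simplices are
   checked with coordinate forms.  As y_m squares to zero,
   r_m(s) >= r_(m+1)(s) + r_(m+1)(s+1), so all these bounds are equalities and
   multiplication by y_m on y_0 ... y_(m-1) K{C} is exact in degrees < d.
   Exactness means that every standard set extends to a standard d-set by adding
   its largest missing vertices, and c_k = r_k(d) means that a standard d-set
   missing n - k contains {n-d+k, ..., n-k-1}. *)

From HB Require Import structures.
Require Import Defs.
From mathcomp Require Import all_boot all_order all_algebra.
From mathcomp Require Import zify ring.
From mathcomp Require Import boolp classical_sets cardinality.
From mathcomp Require mpoly.
Import (canonicals) mpoly.
Import mathcomp.boot.fintype mathcomp.boot.finset.

Set Implicit Arguments.
Unset Strict Implicit.
Unset Printing Implicit Defensive.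

Import Order.TTheory GRing.Theory Num.Theory.
Local Open Scope ring_scope.

(** * Exterior multiplication and interior products *)

Section Operators.
Variables (K : fieldType) (n : nat).
(** [K^o] is [K] as a module over itself; it gives the exterior algebra of the statement its vector
    space structure. *)
Local Notation E := {ffun {set 'I_n} -> K^o}.
Implicit Types (F G H : {set 'I_n}) (X Y : {set {set 'I_n}}) (u v : E).
Implicit Types (i j : 'I_n) (a b : 'I_n -> K).

(** The sign in e_i /\ e_H = [pos_sign i H] e_(i |: H) for i outside H: e_i moves past the smaller
    elements of H. *)
Definition pos_sign i H : K := (-1) ^+ #|[set h in H | (h < i)%N]|.

Lemma pos_sign_sqr i H : pos_sign i H * pos_sign i H = 1.
Proof. by rewrite -expr2 sqrr_sign. Qed.

Lemma pos_sign_neq0 i H : pos_sign i H != 0.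
Proof. by rewrite signr_eq0. Qed.

Lemma pos_signU1 i j H : j \notin H ->
  pos_sign i (j |: H) = (if (j < i)%N then -1 else 1) * pos_sign i H.
Proof.
move=> jH; rewrite /pos_sign; case: ifP => ji.
  rewrite -exprS; congr (_ ^+ _).
  have -> : [set h in j |: H | (h < i)%N] = j |: [set h in H | (h < i)%N].
    by apply/setP => h; rewrite !inE; case: (eqVneq h j) => [->|//]; rewrite ji.
  by rewrite cardsU1 inE (negbTE jH).
rewrite mul1r; congr (_ ^+ _); apply: eq_card => h; rewrite !inE.
by case: (eqVneq h j) => [->|//]; rewrite ji !andbF.
Qed.

Lemma pos_signD1 i j H : j \in H ->
  pos_sign i (H :\ j) = (if (j < i)%N then -1 else 1) * pos_sign i H.
Proof.
move=> jH; rewrite -{2}(setD1K jH) pos_signU1 ?setD11 //.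
by case: ifP; rewrite ?mul1r // mulrA mulrNN !mul1r.
Qed.

Definition wedge1 i u : E :=
  [ffun H : {set 'I_n} => if i \in H then pos_sign i H * u (H :\ i) else 0].

(** The interior product with the dual basis vector of e_i, adjoint to [wedge1 i]. *)
Definition interior i u : E :=
  [ffun H : {set 'I_n} => if i \in H then 0 else pos_sign i H * u (i |: H)].

Definition wedge a u : E := \sum_i a i *: wedge1 i u.

(** For [X] the faces of a fixed size this models the passage to the face ring in that degree, where
    the monomials of [X] form a basis. *)
Definition restrict X u : E := [ffun F => if F \in X then u F else 0].

Lemma wedge1_is_linear i : linear (wedge1 i).
Proof.
move=> c u v; apply/ffunP => H; rewrite !ffunE; case: ifP => _.
  by rewrite mulrDr; congr (_ + _); rewrite /GRing.scale /= mulrCA.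
by rewrite scaler0 addr0.
Qed.

Lemma interior_is_linear i : linear (interior i).
Proof.
move=> c u v; apply/ffunP => H; rewrite !ffunE; case: ifP => _.
  by rewrite scaler0 addr0.
by rewrite mulrDr; congr (_ + _); rewrite /GRing.scale /= mulrCA.
Qed.

Lemma restrict_is_linear X : linear (restrict X).
Proof.
move=> c u v; apply/ffunP => H; rewrite !ffunE; case: ifP => _ //.
by rewrite scaler0 addr0.
Qed.

HB.instance Definition _ i :=
  GRing.isLinear.Build K E E *:%R (wedge1 i) (wedge1_is_linear i).
HB.instance Definition _ i :=
  GRing.isLinear.Build K E E *:%R (interior i) (interior_is_linear i).
HB.instance Definition _ X :=
  GRing.isLinear.Build K E E *:%R (restrict X) (restrict_is_linear X).

Lemma wedge_is_linear a : linear (wedge a).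
Proof.
move=> c u v; rewrite /wedge scaler_sumr -big_split; apply: eq_bigr => i _ /=.
by rewrite linearP scalerDr !scalerA [c * _]mulrC.
Qed.

HB.instance Definition _ a :=
  GRing.isLinear.Build K E E *:%R (wedge a) (wedge_is_linear a).

Lemma wedge1_sqr i u : wedge1 i (wedge1 i u) = 0.
Proof.
apply/ffunP => H; rewrite !ffunE setD11; case: ifP => // _.
by rewrite mulr0.
Qed.

Lemma wedge1_anti i j u : i != j -> wedge1 i (wedge1 j u) = - wedge1 j (wedge1 i u).
Proof.
move=> ij; apply/ffunP => H; rewrite !ffunE !inE ij eq_sym ij /=.
case: ifP => iH; case: ifP => jH; rewrite ?mulr0 ?oppr0 //.
rewrite !pos_signD1 // setDDl [[set i] :|: _]setUC -setDDl.
case: (ltngtP i j) => [_|_|/val_inj e]; rewrite ?mul1r ?mulN1r; [ring|ring|].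
by rewrite e eqxx in ij.
Qed.

Lemma interior_wedge1 i j u :
  interior i (wedge1 j u) = (i == j)%:R *: u - wedge1 j (interior i u).
Proof.
apply/ffunP => H; rewrite !ffunE !inE; case: (eqVneq i j) => [<-|ij] /=.
  rewrite scale1r; case: ifP => iH.
    by rewrite pos_signD1 // ltnn mul1r mulrA pos_sign_sqr mul1r setD1K // subrr.
  by rewrite setU1K ?iH // subr0 pos_signU1 ?iH // ltnn mul1r mulrA pos_sign_sqr mul1r.
rewrite scale0r add0r.
case: ifP => iH; case: ifP => jH; rewrite ?mulr0 ?oppr0 //.
rewrite pos_signU1 ?iH // pos_signD1 //.
have -> : (i |: H) :\ j = i |: H :\ j.
  by apply/setP => h; rewrite !inE; case: (eqVneq h i) => [->|]; rewrite ?ij.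
case: (ltngtP i j) => [_|_|/val_inj e]; rewrite ?mul1r ?mulN1r; [ring|ring|].
by rewrite e eqxx in ij.
Qed.

Lemma wedgeE a u H :
  wedge a u H = \sum_(i in H) a i * (pos_sign i H * u (H :\ i)).
Proof.
rewrite /wedge sum_ffunE [RHS]big_mkcond; apply: eq_bigr => i _.
by rewrite !ffunE; case: ifP; rewrite ?scaler0.
Qed.

Lemma wedge_anti a b u : wedge a (wedge b u) = - wedge b (wedge a u).
Proof.
have aux c e v : wedge c (wedge e v) =
    \sum_i \sum_j (c i * e j) *: wedge1 i (wedge1 j v).
  rewrite /wedge; apply: eq_bigr => i _; rewrite linear_sum scaler_sumr.
  by apply: eq_bigr => j _; rewrite linearZ scalerA.
rewrite !aux exchange_big -sumrN; apply: eq_bigr => i _ /=.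
rewrite -sumrN; apply: eq_bigr => j _; have [->|ij] := eqVneq i j.
  by rewrite wedge1_sqr !scaler0 oppr0.
by rewrite wedge1_anti 1?eq_sym // scalerN mulrC.
Qed.

(** Anticommutation alone does not give this in characteristic 2. The diagonal terms vanish because
    e_i squares to zero, and the others cancel in pairs under swapping the two indices. *)
Lemma wedge_sqr a u : wedge a (wedge a u) = 0.
Proof.
have aux v : wedge a (wedge a v) =
    \sum_i \sum_j (a i * a j) *: wedge1 i (wedge1 j v).
  rewrite /wedge; apply: eq_bigr => i _; rewrite linear_sum scaler_sumr.
  by apply: eq_bigr => j _; rewrite linearZ scalerA.
rewrite aux pair_big /= (bigID (fun p : 'I_n * 'I_n => p.1 == p.2)) /=.
rewrite big1 => [|[i j] /= /eqP->]; last by rewrite wedge1_sqr scaler0.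
rewrite add0r (bigID (fun p : 'I_n * 'I_n => (p.1 < p.2)%N)) /=.
have swap_inj : injective (fun p : 'I_n * 'I_n => (p.2, p.1)).
  by move=> [i j] [k l] [-> ->].
rewrite [X in _ + X](reindex_inj swap_inj) /=.
rewrite -[X in _ + X]opprK -sumrN; apply/eqP; rewrite subr_eq0; apply/eqP.
apply: eq_big => [[i j]|[i j]] /=.
  rewrite eq_sym -leqNgt; case: (eqVneq j i) => //= ij.
  by rewrite ltn_neqAle; case: (eqVneq (i : nat) j) => // /ord_inj e; rewrite e eqxx in ij.
by case/andP => ij _; rewrite wedge1_anti // scalerN mulrC.
Qed.

End Operators.

(** * Products of linear forms *)

Section Words.
Variables (K : fieldType) (n : nat).
Local Notation E := {ffun {set 'I_n} -> K^o}.
Implicit Types (F G H : {set 'I_n}) (X Y : {set {set 'I_n}}) (u v : E).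
Implicit Types (i j : 'I_n) (a b : 'I_n -> K).

(** Left multiplication by the product of the forms [f l], for l running through the word [w] in
    order. *)
Definition wedges (T : Type) (f : T -> 'I_n -> K) (w : seq T) u : E :=
  foldr (fun l => wedge (f l)) u w.

Lemma wedges_is_linear T (f : T -> 'I_n -> K) w : linear (wedges f w).
Proof. by move=> c u v; elim: w => //= l w ->; rewrite linearP. Qed.

HB.instance Definition _ T (f : T -> 'I_n -> K) w :=
  GRing.isLinear.Build K E E *:%R (wedges f w) (wedges_is_linear f w).

Lemma wedges_cat T (f : T -> 'I_n -> K) w1 w2 u :
  wedges f (w1 ++ w2) u = wedges f w1 (wedges f w2 u).
Proof. exact: foldr_cat. Qed.

Lemma wedge_wedges T (f : T -> 'I_n -> K) w a u :
  wedge a (wedges f w u) = (-1) ^+ size w *: wedges f w (wedge a u).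
Proof.
elim: w => [|l w IH] /=; first by rewrite scale1r.
by rewrite wedge_anti IH linearZ exprS mulN1r scaleNr.
Qed.

Lemma eq_wedges (T : eqType) (f g : T -> 'I_n -> K) w u :
  {in w, forall l, wedge (f l) =1 wedge (g l)} -> wedges f w u = wedges g w u.
Proof.
elim: w => //= l w IH fg; rewrite IH => [|k kw]; last by apply: fg; rewrite inE kw orbT.
by apply: fg; rewrite inE eqxx.
Qed.

Definition coord_form i : 'I_n -> K := fun l => (l == i)%:R.

Lemma wedge_coord i u : wedge (coord_form i) u = wedge1 i u.
Proof.
rewrite /wedge (bigD1 i) //= /coord_form eqxx scale1r big1 ?addr0 // => l li.
by rewrite (negbTE li) scale0r.
Qed.

Lemma wedge1_interior i u H :
  wedge1 i (interior i u) H = if i \in H then u H else 0.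
Proof.
rewrite !ffunE; case: ifP => // iH.
by rewrite setD11 pos_signD1 // ltnn mul1r mulrA pos_sign_sqr mul1r setD1K.
Qed.

(** Interior products divide out one coordinate vector at a time; since the vertices of the word are
    distinct, each quotient still contains the remaining ones in its support. *)
Lemma wedges_coord_supp T (f : T -> 'I_n -> K) (v : T -> 'I_n) w u :
    (forall l, List.In l w -> wedge (f l) =1 wedge1 (v l)) -> uniq (map v w) ->
    (forall G, u G != 0 -> {subset map v w <= G}) ->
  exists y, u = wedges f w y.
Proof.
elim: w u => [|l w IH] u fv /=; first by exists u.
case/andP => vl uw supp.
have [||G uG|y ey] := IH (interior (v l) u).
- by move=> k kw; apply: fv; right.
- by [].
- move=> x xw; move: uG; rewrite ffunE; case: ifP => [|vG]; first by rewrite eqxx.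
  rewrite mulf_eq0 negb_or => /andP[_ /supp sub].
  have := sub x; rewrite inE xw orbT => /(_ isT); rewrite !inE.
  by case: eqP => // e; rewrite -e xw in vl.
exists y; rewrite -ey fv; last by left.
apply/ffunP => G; rewrite wedge1_interior; case: ifP => // vG.
apply/eqP; apply: contraFT vG => /supp; apply; exact: mem_head.
Qed.

Lemma wedges_coord_sub T (f : T -> 'I_n -> K) (v : T -> 'I_n) w u G :
    (forall l, List.In l w -> wedge (f l) =1 wedge1 (v l)) ->
    wedges f w u G != 0 -> {subset map v w <= G}.
Proof.
elim: w u G => [|l w IH] u G fv //=; rewrite fv; last by left.
rewrite ffunE; case: ifP => [lG|]; last by rewrite eqxx.
rewrite mulf_eq0 negb_or => /andP[_ /IH]  sub x; rewrite inE.
case/orP => [/eqP->//|]; move/(sub _) => sx; have: x \in G :\ v l.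
  by apply: sx => k kw; apply: fv; right.
by rewrite inE => /andP[].
Qed.

Definition hdeg (s : nat) : {set {set 'I_n}} := [set F : {set 'I_n} | #|F| == s].

(** Makes multiplication by a form well defined on face rings: the coefficient at F involves only
    the coefficients at the sets [F :\ i]. *)
Lemma restrict_wedge X Y a u :
    (forall F i, F \in X -> i \in F -> F :\ i \in Y) ->
  restrict X (wedge a (restrict Y u)) = restrict X (wedge a u).
Proof.
move=> XY; apply/ffunP => F; rewrite !ffunE; case: ifP => // FX.
by rewrite !wedgeE; apply: eq_bigr => i iF; rewrite ffunE XY.
Qed.

End Words.

(** * Dimensions of sums of images of linear operators *)

Section Ranks.
Variables (K : fieldType) (n : nat).
Local Notation E := {ffun {set 'I_n} -> K^o}.
Local Notation N := #|{set 'I_n}|.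
Implicit Types (F G H : {set 'I_n}) (X Y : {set {set 'I_n}}) (u v : E).

Definition mono F : E := ext_monomial K F.

Lemma monoE F G : mono F G = (G == F)%:R.
Proof. by rewrite ffunE. Qed.

Lemma mono_decomp u : u = \sum_F u F *: mono F.
Proof.
apply/ffunP => G; rewrite sum_ffunE (bigD1 G) //= !ffunE eqxx big1 => [|F FG].
  by rewrite addr0 /GRing.scale /= mulr1.
by rewrite !ffunE eq_sym (negbTE FG) scaler0.
Qed.

Definition to_row u : 'rV[K]_N := \row_i u (enum_val i).
Definition of_row (r : 'rV[K]_N) : E := [ffun F => r 0 (enum_rank F)].

Lemma to_rowK : cancel to_row of_row.
Proof. by move=> u; apply/ffunP => F; rewrite ffunE mxE enum_rankK. Qed.

Lemma of_rowK : cancel of_row to_row.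
Proof. by move=> r; apply/rowP => i; rewrite mxE ffunE enum_valK. Qed.

Lemma to_rowD u v : to_row (u + v) = to_row u + to_row v.
Proof. by apply/rowP => i; rewrite !mxE ffunE. Qed.

Definition op_mx (g : E -> E) : 'M[K]_N :=
  \matrix_(i, j) g (mono (enum_val i)) (enum_val j).

Lemma op_mxE (g : {linear E -> E}) u : to_row (g u) = to_row u *m op_mx g.
Proof.
apply/rowP => j; rewrite !mxE {1}(mono_decomp u) linear_sum sum_ffunE.
rewrite (reindex_onto enum_val enum_rank) => [|F _]; last exact: enum_rankK.
apply: eq_big => [i|i _]; first by rewrite enum_valK eqxx.
by rewrite !mxE linearZ !ffunE.
Qed.

(** For linear [g1] and [g2] this is dim (im g1 + im g2). Two summands are allowed because the ideal
    behind c_k has two generators; a single image is the case [g1 = g2]. *)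
Definition rank2 (g1 g2 : E -> E) : nat := \rank (op_mx g1 + op_mx g2)%MS.

Lemma sub_imageP (g1 g2 : {linear E -> E}) u :
  reflect (exists v1 v2, u = g1 v1 + g2 v2)
          (to_row u <= op_mx g1 + op_mx g2)%MS.
Proof.
apply: (iffP sub_addsmxP) => [[[r1 r2] /= e]|[v1 [v2 ->]]].
  exists (of_row r1), (of_row r2); apply: (can_inj to_rowK).
  by rewrite to_rowD !op_mxE !of_rowK.
by exists (to_row v1, to_row v2); rewrite to_rowD !op_mxE.
Qed.

Lemma op_mx_subP (h : {linear E -> E}) m (A : 'M_(m, N)) :
  (forall u, (to_row (h u) <= A)%MS) -> (op_mx h <= A)%MS.
Proof.
move=> hA; apply/row_subP => i.
have -> : row i (op_mx h) = to_row (h (mono (enum_val i))).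
  by apply/rowP => j; rewrite !mxE.
exact: hA.
Qed.

Lemma op_mx_sub (h g1 g2 : {linear E -> E}) :
    (forall u, exists v1 v2, h u = g1 v1 + g2 v2) ->
  (op_mx h <= op_mx g1 + op_mx g2)%MS.
Proof. by move=> hg; apply: op_mx_subP => u; apply/sub_imageP; apply: hg. Qed.

Lemma rank2_le (h1 h2 g1 g2 : {linear E -> E}) :
    (forall u, exists v1 v2, h1 u = g1 v1 + g2 v2) ->
    (forall u, exists v1 v2, h2 u = g1 v1 + g2 v2) ->
  (rank2 h1 h2 <= rank2 g1 g2)%N.
Proof. by move=> s1 s2; apply: mxrankS; rewrite addsmx_sub !op_mx_sub. Qed.

Lemma op_mx_comp (h g : {linear E -> E}) :
  op_mx (h \o g) = op_mx g *m op_mx h.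
Proof.
apply/row_matrixP => i; rewrite row_mul.
have rowE (k : {linear E -> E}) : row i (op_mx k) = to_row (k (mono (enum_val i))).
  by apply/rowP => j; rewrite !mxE.
by rewrite (rowE g) (rowE (h \o g)) /= op_mxE.
Qed.

Lemma rank2_compE (p g1 g2 : {linear E -> E}) :
  rank2 (p \o g1) (p \o g2) = \rank ((op_mx g1 + op_mx g2)%MS *m op_mx p).
Proof. by rewrite /rank2 !op_mx_comp addsmxMr. Qed.

Lemma rank2_comp (p g1 g2 : {linear E -> E}) :
  (rank2 (p \o g1) (p \o g2) <= rank2 g1 g2)%N.
Proof.
by rewrite rank2_compE mxrankM_maxl.
Qed.

Lemma rank2_eq (g g' h h' : {linear E -> E}) :
  g =1 g' -> h =1 h' -> rank2 g h = rank2 g' h'.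
Proof.
by move=> gg hh; congr (\rank (_ + _)%MS); apply/matrixP => i j; rewrite !mxE ?gg ?hh.
Qed.

(** Rank-nullity for [b] on im g1 + im g2, where the kernel contains im h1 + im h2. *)
Lemma rank2_ker (b h1 h2 g1 g2 : {linear E -> E}) :
    (forall u, exists v1 v2, h1 u = g1 v1 + g2 v2) ->
    (forall u, exists v1 v2, h2 u = g1 v1 + g2 v2) ->
    (forall u, b (h1 u) = 0) -> (forall u, b (h2 u) = 0) ->
  (rank2 h1 h2 + rank2 (b \o g1) (b \o g2) <= rank2 g1 g2)%N.
Proof.
move=> s1 s2 b1 b2; rewrite rank2_compE /rank2.
rewrite -(mxrank_mul_ker (op_mx g1 + op_mx g2)%MS (op_mx b)) addnC leq_add2l.
apply: mxrankS; rewrite sub_capmx addsmx_sub !op_mx_sub //= addsmx_sub.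
have z (h : {linear E -> E}) : (forall u, b (h u) = 0) -> (op_mx h <= kermx (op_mx b))%MS.
  move=> bh; apply: op_mx_subP => u; apply/sub_kermxP; rewrite -op_mxE bh.
  by apply/rowP => i; rewrite !mxE ffunE.
by rewrite !z.
Qed.

(* When the inequality of [rank2_ker] is an equality, the sequence
   [im h -> im g -> im (b o g)] is exact. *)
Lemma rank2_exact (b h1 h2 g1 g2 : {linear E -> E}) :
    (forall u, exists v1 v2, h1 u = g1 v1 + g2 v2) ->
    (forall u, exists v1 v2, h2 u = g1 v1 + g2 v2) ->
    (forall u, b (h1 u) = 0) -> (forall u, b (h2 u) = 0) ->
    (rank2 g1 g2 <= rank2 h1 h2 + rank2 (b \o g1) (b \o g2))%N ->
  forall u, b (g1 u) = 0 -> exists v1 v2, g1 u = h1 v1 + h2 v2.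
Proof.
move=> s1 s2 b1 b2; rewrite rank2_compE /rank2.
rewrite -(mxrank_mul_ker (op_mx g1 + op_mx g2)%MS (op_mx b)) addnC leq_add2r => le u bu.
have z (h : {linear E -> E}) : (forall u, b (h u) = 0) -> (op_mx h <= kermx (op_mx b))%MS.
  move=> bh; apply: op_mx_subP => v; apply/sub_kermxP; rewrite -op_mxE bh.
  by apply/rowP => i; rewrite !mxE ffunE.
have sub : (op_mx h1 + op_mx h2 <= (op_mx g1 + op_mx g2) :&: kermx (op_mx b))%MS.
  by rewrite sub_capmx addsmx_sub !op_mx_sub //= addsmx_sub !z.
apply/sub_imageP; rewrite (geq_leqif (mxrank_leqif_sup sub)) in le.
apply: submx_trans le; rewrite sub_capmx; apply/andP; split.
  by apply/sub_imageP; exists u, 0; rewrite linear0 addr0.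
by apply/sub_kermxP; rewrite -op_mxE bu; apply/rowP => i; rewrite !mxE ffunE.
Qed.

Lemma rank2_inj (b g : {linear E -> E}) :
  (forall u, b (g u) = 0 -> g u = 0) -> (rank2 g g <= rank2 (b \o g) (b \o g))%N.
Proof.
move=> bg; rewrite rank2_compE /rank2.
rewrite -(mxrank_mul_ker (op_mx g + op_mx g)%MS (op_mx b)) -[X in (_ <= X)%N]addn0 leq_add2l.
rewrite leqn0 mxrank_eq0 -submx0; apply/row_subP => i.
set r := row i _; have : (r <= (op_mx g + op_mx g) :&: kermx (op_mx b))%MS by apply: row_sub.
rewrite sub_capmx -(of_rowK r) => /andP[/sub_imageP[v1 [v2 e]] /sub_kermxP].
rewrite -op_mxE e -linearD /= => bz.
have: b (g (v1 + v2)) = 0.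
  by apply: (can_inj to_rowK); rewrite bz; apply/rowP => k; rewrite !mxE ffunE.
by move/bg => ->; rewrite submx0; apply/eqP/rowP => k; rewrite !mxE ffunE.
Qed.

Lemma rank2_full (h1 h2 g1 g2 : {linear E -> E}) :
    (forall u, exists v1 v2, h1 u = g1 v1 + g2 v2) ->
    (forall u, exists v1 v2, h2 u = g1 v1 + g2 v2) ->
    (rank2 g1 g2 <= rank2 h1 h2)%N ->
  forall u, exists v1 v2, g1 u = h1 v1 + h2 v2.
Proof.
move=> s1 s2 le u.
have sub : (op_mx h1 + op_mx h2 <= op_mx g1 + op_mx g2)%MS by rewrite addsmx_sub !op_mx_sub.
apply/sub_imageP; rewrite /rank2 (geq_leqif (mxrank_leqif_sup sub)) in le.
by apply: submx_trans le; apply/sub_imageP; exists u, 0; rewrite linear0 addr0.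
Qed.

Definition mono_mx X : 'M[K]_(#|X|, N) := \matrix_(i < #|X|) to_row (mono (enum_val i)).

Lemma rank_mono_mx X : \rank (mono_mx X) = #|X|.
Proof.
apply/eqP; rewrite -/(row_free _); apply/row_freeP; exists (mono_mx X)^T.
apply/matrixP => i j; rewrite !mxE (bigD1 (enum_rank (enum_val i))) //= !mxE.
rewrite !enum_rankK !monoE eqxx mul1r big1 ?addr0 => [|k ki].
  by rewrite (inj_eq enum_val_inj).
rewrite !mxE monoE; case: eqP => [e|_]; last by rewrite mul0r.
by rewrite -e enum_valK eqxx in ki.
Qed.

Lemma rank2_ge_card (g1 g2 : {linear E -> E}) X :
    (forall F, F \in X -> exists v1 v2, mono F = g1 v1 + g2 v2) ->
  (#|X| <= rank2 g1 g2)%N.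
Proof.
move=> Xg; rewrite -rank_mono_mx; apply: mxrankS; apply/row_subP => i.
by rewrite rowK; apply/sub_imageP/Xg/enum_valP.
Qed.

Lemma rank2_restrict X : rank2 (restrict X) (restrict X) = #|X|.
Proof.
apply/eqP; rewrite eqn_leq; apply/andP; split; last first.
  apply: rank2_ge_card => F FX; exists (mono F), 0; rewrite linear0 addr0.
  apply/ffunP => G; rewrite [RHS]ffunE !monoE; case: ifP => // GX.
  by case: eqP => // GF; rewrite GF FX in GX.
apply: leq_trans (rank_leq_row (mono_mx X)).
apply: mxrankS; rewrite addsmx_sub andbb; apply: op_mx_subP => u.
rewrite /= (mono_decomp (restrict X u)).
have -> : to_row (\sum_F restrict X u F *: mono F) =
    \sum_F restrict X u F *: to_row (mono F).
  apply/rowP => j; rewrite mxE sum_ffunE summxE; apply: eq_bigr => F _.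
  by rewrite !mxE ffunE.
apply: summx_sub => F _; rewrite ffunE; case: ifP => FX; last first.
  by rewrite scale0r sub0mx.
apply: scalemx_sub; rewrite -(enum_rankK_in FX FX).
by apply: (eq_row_sub (enum_rank_in FX F)); rewrite rowK.
Qed.

End Ranks.

(** * Generic ranks *)

Section FunctionRings.
Variables (K : fieldType) (X : Type).

(** Covers both the polynomial functions of matrix entries and the functions that are polynomial
    along curves, so that semicontinuity of ranks is proved once for both. *)
Definition function_ring (R : (X -> K) -> Prop) : Prop :=
  [/\ forall c, R (fun=> c),
      forall p q, R p -> R q -> R (fun x => p x + q x) &
      forall p q, R p -> R q -> R (fun x => p x * q x)].

Variable R : (X -> K) -> Prop.
Hypothesis ringR : function_ring R.

Lemma function_ring_sum (I : Type) (r : seq I) (P : pred I) (p : I -> X -> K) :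
  (forall i, R (p i)) -> R (fun x => \sum_(i <- r | P i) p i x).
Proof.
case: ringR => Rc Ra _ Rp; elim: r => [|i r IH].
  by have -> : (fun x => \sum_(i <- [::] | P i) p i x) = fun=> 0;
    [apply/funext => x; rewrite big_nil|exact: Rc].
have -> : (fun x => \sum_(k <- i :: r | P k) p k x) =
    fun x => (if P i then p i x else 0) + \sum_(k <- r | P k) p k x.
  by apply/funext => x; rewrite big_cons; case: ifP; rewrite ?add0r.
by apply: Ra => //; case: (P i).
Qed.

Lemma function_ring_prod (I : Type) (r : seq I) (P : pred I) (p : I -> X -> K) :
  (forall i, R (p i)) -> R (fun x => \prod_(i <- r | P i) p i x).
Proof.
case: ringR => Rc _ Rm Rp; elim: r => [|i r IH].
  by have -> : (fun x => \prod_(i <- [::] | P i) p i x) = fun=> 1;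
    [apply/funext => x; rewrite big_nil|exact: Rc].
have -> : (fun x => \prod_(k <- i :: r | P k) p k x) =
    fun x => (if P i then p i x else 1) * \prod_(k <- r | P k) p k x.
  by apply/funext => x; rewrite big_cons; case: ifP; rewrite ?mul1r.
by apply: Rm => //; case: (P i).
Qed.

Lemma function_ring_exp p k : R p -> R (fun x => p x ^+ k).
Proof.
move=> Rp; have -> : (fun x => p x ^+ k) = fun x => \prod_(i < k) p x.
  by apply/funext => x; rewrite prodr_const card_ord.
exact: function_ring_prod.
Qed.

Lemma function_ring_det m (A : X -> 'M[K]_m) :
  (forall i j, R (fun x => A x i j)) -> R (fun x => \det (A x)).
Proof.
move=> RA; rewrite /determinant; apply: function_ring_sum => s.
case: ringR => Rc _ Rm; apply: (Rm _ _ (Rc _)).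
by apply: function_ring_prod.
Qed.

(* A rank-[r] matrix [A x0] has one-sided inverses [P *m A x0 *m Q = 1] of size
   [r], and [\det (P *m A x *m Q)] then certifies rank at least [r]. *)
Lemma rank_lower_semicontinuous m p (A : X -> 'M[K]_(m, p)) :
    (forall i j, R (fun x => A x i j)) ->
  forall x0, exists q, [/\ R q, q x0 != 0 &
    forall x, q x != 0 -> (\rank (A x0) <= \rank (A x))%N].
Proof.
move=> RA x0; case: ringR => Rc _ Rm.
pose P := pinvmx (col_base (A x0)); pose Q := pinvmx (row_base (A x0)).
have PAQ : P *m A x0 *m Q = 1%:M.
  rewrite -[X in P *m X *m _](mulmx_base (A x0)) mulmxA mulVpmx ?col_base_full // mul1mx.
  by rewrite mulmxVp // row_base_free.
exists (fun x => \det (P *m A x *m Q)); split.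
- apply: function_ring_det => i j.
  have -> : (fun x => (P *m A x *m Q) i j) =
      fun x => \sum_k (\sum_l P i l * A x l k) * Q k j.
    by apply/funext => x; rewrite mxE; apply: eq_bigr => k _; rewrite mxE.
  apply: function_ring_sum => k; apply: (Rm _ _) => //.
  by apply: function_ring_sum => l; apply: Rm.
- by rewrite PAQ det1 oner_eq0.
- move=> x; rewrite -unitfE -unitmxE -row_full_unit => /eqP {1}<-.
  by apply: leq_trans (mxrankM_maxl _ _) (mxrankM_maxr _ _).
Qed.

End FunctionRings.

(** * Openness tested along polynomial curves *)

Section CurvePolynomials.
Variables (K : fieldType) (X : Type) (curve : (K -> X) -> Prop).
Hypothesis K_infinite : infinite_set [set: K]%classic.
Hypothesis curve_join : forall a b, exists g, [/\ curve g, g 0 = a & g 1 = b].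

(** The forms are indexed by all natural numbers, so their parameter space is not a
    finite-dimensional affine space. Being a univariate polynomial along each curve replaces being a
    polynomial, which suffices because any two points lie on a curve. *)
Definition curve_poly (q : X -> K) : Prop :=
  forall g, curve g -> exists p : {poly K}, forall t, q (g t) = p.[t].

Lemma curve_poly_ring : function_ring curve_poly.
Proof.
split=> [c g cg|p q hp hq g cg|p q hp hq g cg].
- by exists c%:P => t; rewrite hornerC.
- have [p1 e1] := hp g cg; have [p2 e2] := hq g cg.
  by exists (p1 + p2) => t; rewrite hornerD e1 e2.
- have [p1 e1] := hp g cg; have [p2 e2] := hq g cg.
  by exists (p1 * p2) => t; rewrite hornerM e1 e2.
Qed.

(** The analogue of Zariski openness: each point has a neighbourhood where some [curve_poly]
    function does not vanish. *)
Definition curve_open (P : X -> Prop) : Prop :=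
  forall x0, P x0 -> exists q, [/\ curve_poly q, q x0 != 0 & forall x, q x != 0 -> P x].

Lemma curve_open_and P Q :
  curve_open P -> curve_open Q -> curve_open (fun x => P x /\ Q x).
Proof.
move=> oP oQ x0 [/oP[p [lp p0 hp]] /oQ[q [lq q0 hq]]].
exists (fun x => p x * q x); split.
- by case: curve_poly_ring => _ _; apply.
- by rewrite mulf_neq0.
- by move=> x; rewrite mulf_eq0 negb_or => /andP[/hp ? /hq].
Qed.

Lemma poly_nonroot (p : {poly K}) : p != 0 -> exists t, p.[t] != 0.
Proof.
move=> p0; apply: contrapT => no.
have [B _ sB] := infinite_set_fset (size p) K_infinite.
have := max_poly_roots p0 (rs := finmap.enum_fset B) _ (finmap.fset_uniq B).
rewrite ltnNge sB => /(_ _)/negP; apply=> //; apply/allP => t _.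
by apply/rootP/eqP; apply: contrapT => /negP pt; apply: no; exists t.
Qed.

(** Along a curve joining a point of [P] to a point of [Q], the two certificates become nonzero
    polynomials in one variable; over an infinite field their product has a nonroot. *)
Lemma curve_open_meet P Q :
  curve_open P -> curve_open Q -> (exists x, P x) -> (exists x, Q x) ->
  exists x, P x /\ Q x.
Proof.
move=> oP oQ [a /oP[p [lp pa hp]]] [b /oQ[q [lq qb hq]]].
have [g [cg ga gb]] := curve_join a b.
have [p1 e1] := lp g cg; have [p2 e2] := lq g cg.
have [|t] := @poly_nonroot (p1 * p2).
  apply: mulf_neq0.
    by apply: contraNneq pa => z; rewrite -ga e1 z horner0.
  by apply: contraNneq qb => z; rewrite -gb e2 z horner0.
rewrite hornerM mulf_eq0 negb_or -e1 -e2 => /andP[/hp ? /hq ?].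
by exists (g t).
Qed.

Definition generic (P : X -> Prop) := curve_open P /\ exists x, P x.

Lemma generic_and P Q : generic P -> generic Q -> generic (fun x => P x /\ Q x).
Proof.
move=> [oP eP] [oQ eQ]; split; first exact: curve_open_and.
exact: curve_open_meet.
Qed.

Lemma eq_generic (P Q : X -> Prop) : (forall x, P x <-> Q x) -> generic P -> generic Q.
Proof.
move=> PQ [oP [x Px]]; split; last by exists x; apply/PQ.
by move=> x0 /PQ/oP[q [lq q0 hq]]; exists q; split=> // y /hq/PQ.
Qed.

(** The point [x0] serves for the empty conjunction. *)
Lemma generic_all (P : nat -> X -> Prop) (x0 : X) m :
    (forall k, (k < m)%N -> generic (P k)) ->
  generic (fun x => forall k, (k < m)%N -> P k x).
Proof.
elim: m => [|m IH] gP.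
  split; last by exists x0.
  move=> x _; exists (fun=> 1); split=> //; last by rewrite oner_eq0.
  by case: curve_poly_ring => + _ _; apply.
have g1 : generic (fun x => forall k, (k < m)%N -> P k x).
  by apply: IH => k km; apply: gP; rewrite ltnW.
apply: eq_generic (generic_and g1 (gP m (ltnSn m))) => x; split.
  by move=> [h Pm] k; rewrite ltnS leq_eqVlt => /orP[/eqP->|/h].
by move=> h; split=> [k km|]; apply: h => //; rewrite ltnW.
Qed.

End CurvePolynomials.

Section OpenRank.
Variables (K : fieldType) (n : nat) (X : Type) (R : (X -> K) -> Prop).
Hypothesis ringR : function_ring R.
Local Notation E := {ffun {set 'I_n} -> K^o}.
Local Notation N := #|{set 'I_n}|.

Lemma rank2_lower_semicontinuous (g1 g2 : X -> E -> E) :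
    (forall u F, R (fun x => g1 x u F)) -> (forall u F, R (fun x => g2 x u F)) ->
  forall x0, exists q, [/\ R q, q x0 != 0 &
    forall x, q x != 0 -> (rank2 (g1 x0) (g2 x0) <= rank2 (g1 x) (g2 x))%N].
Proof.
move=> R1 R2 x0.
(* The sum of two row spaces is the row space of the stacked matrix, whose entries lie in [R]. *)
have [|q [Rq q0 hq]] := @rank_lower_semicontinuous _ _ R ringR (N + N) N
    (fun x => col_mx (op_mx (g1 x)) (op_mx (g2 x))) _ x0.
  move=> i j; case: (splitP i) => k e.
    have -> : (fun x => col_mx (op_mx (g1 x)) (op_mx (g2 x)) i j) =
      fun x => g1 x (mono K (enum_val k)) (enum_val j).
      apply/funext => x; have -> : i = lshift N k by apply: val_inj.
      by rewrite col_mxEu mxE.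
    exact: R1.
  have -> : (fun x => col_mx (op_mx (g1 x)) (op_mx (g2 x)) i j) =
      fun x => g2 x (mono K (enum_val k)) (enum_val j).
    apply/funext => x; have -> : i = rshift N k by apply: val_inj.
    by rewrite col_mxEd mxE.
  exact: R2.
by exists q; split=> // x /hq; rewrite /rank2 !addsmxE.
Qed.

Lemma wedges_fun_ring (T : Type) (f : X -> T -> 'I_n -> K) w u F :
  (forall l i, R (fun x => f x l i)) -> R (fun x => wedges (f x) w u F).
Proof.
move=> Rf; case: ringR => Rc _ Rm; elim: w F => [|l w IH] F //=.
have -> : (fun x => wedge (f x l) (wedges (f x) w u) F) =
    fun x => \sum_(i in F) f x l i * (pos_sign K i F * wedges (f x) w u (F :\ i)).
  by apply/funext => x; rewrite wedgeE.
by apply: function_ring_sum => // i; apply: (Rm _ _ (Rf _ _)); exact: (Rm _ _ (Rc _)) (IH _).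
Qed.

Lemma linear_fun_ring (p : {linear E -> E}) (g : X -> E) F :
  (forall G, R (fun x => g x G)) -> R (fun x => p (g x) F).
Proof.
move=> Rg; case: ringR => Rc _ Rm.
have -> : (fun x => p (g x) F) = fun x => \sum_G g x G * p (mono K G) F.
  apply/funext => x; rewrite {1}(mono_decomp (g x)) linear_sum sum_ffunE.
  by apply: eq_bigr => G _; rewrite linearZ ffunE.
by apply: function_ring_sum => // G; apply: Rm.
Qed.

End OpenRank.

(** * Edge contractions *)

Section ContractionRank.
Variables (K : fieldType) (n : nat).
Local Notation E := {ffun {set 'I_n} -> K^o}.
Implicit Types (F G H : {set 'I_n}) (X Y Z : {set {set 'I_n}}) (u v : E).
Implicit Types (a b : 'I_n -> K) (f : nat -> 'I_n -> K).
Variables i j : 'I_n.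
Hypothesis ij : i != j.

(* The algebra map e_j |-> e_i + e_j, e_i |-> 0, which is dual to the simplicial
   map of the contraction i |-> j. *)
Definition pullback u : E :=
  interior i (wedge1 i u) + wedge1 i (interior j (interior i (wedge1 i u))).

(** The image of the form [a] under the pullback: e_i is killed and e_j contributes a new e_i, so
    the coefficient at i becomes [a j]. *)
Definition pull_form a : 'I_n -> K := fun l => if l == i then a j else a l.

Lemma pullback_is_linear : linear pullback.
Proof. by move=> c u v; rewrite /pullback !linearP scalerDr; apply: addrACA. Qed.

HB.instance Definition _ :=
  GRing.isLinear.Build K E E *:%R pullback pullback_is_linear.

(** [interior i] after [wedge1 i] sets e_i to zero, and adding e_i /\ [interior j] substitutes e_i +
    e_j for e_j; both operations are multiplicative. *)
Lemma pullback_wedge1 l u :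
  pullback (wedge1 l u) = if l == i then 0 else
    wedge1 l (pullback u) + (l == j)%:R *: wedge1 i (pullback u).
Proof.
case: eqP => [->|/eqP li]; first by rewrite /pullback wedge1_sqr !linear0 addr0.
rewrite /pullback; set p := interior i (wedge1 i u).
have -> : interior i (wedge1 i (wedge1 l u)) = wedge1 l p.
  rewrite wedge1_anti 1?eq_sym // linearN /= interior_wedge1 [i == l]eq_sym (negbTE li).
  by rewrite scale0r add0r opprK.
rewrite (interior_wedge1 j l p) linearB linearZ /= [wedge1 i (wedge1 l _)]wedge1_anti 1?eq_sym // opprK.
rewrite !linearD /= wedge1_sqr ?scaler0 addr0 -!addrA; congr (_ + _).
by rewrite addrC.
Qed.

Lemma pullback_wedge a u : pullback (wedge a u) = wedge (pull_form a) (pullback u).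
Proof.
rewrite {1}/wedge linear_sum /wedge [RHS](bigD1 i) //= {1}/pull_form eqxx.
rewrite (bigD1 i) //= linearZ /= pullback_wedge1 eqxx scaler0 add0r.
under eq_bigr => l li do rewrite linearZ /= pullback_wedge1 (negbTE li) scalerDr.
rewrite big_split /= addrC; congr (_ + _).
  rewrite (bigD1 j) 1?eq_sym //= eqxx scale1r big1 ?addr0 // => l /andP[_ lj].
  by rewrite (negbTE lj) scale0r scaler0.
by apply: eq_bigr => l li; rewrite /pull_form (negbTE li).
Qed.

Definition pull_forms f : nat -> 'I_n -> K := fun l => pull_form (f l).

Lemma pullback_wedges f w u :
  pullback (wedges f w u) = wedges (pull_forms f) w (pullback u).
Proof. by elim: w => //= l w IH; rewrite pullback_wedge IH. Qed.

Lemma interior_wedge1_same u H :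
  interior i (wedge1 i u) H = if i \in H then 0 else u H.
Proof.
rewrite interior_wedge1 eqxx scale1r.
have -> : (u - wedge1 i (interior i u)) H = u H - wedge1 i (interior i u) H.
  by rewrite !ffunE.
by rewrite wedge1_interior; case: ifP; rewrite ?subrr ?subr0.
Qed.

Lemma pullback_out u F : i \notin F -> pullback u F = u F.
Proof.
move=> iF; rewrite /pullback [LHS]ffunE interior_wedge1_same (negbTE iF).
by rewrite ffunE (negbTE iF) addr0.
Qed.

Lemma pullback_both u F : i \in F -> j \in F -> pullback u F = 0.
Proof.
move=> iF jF; rewrite /pullback [LHS]ffunE interior_wedge1_same iF add0r.
by rewrite !ffunE iF !inE eq_sym ij jF mulr0.
Qed.

Lemma pullback_edge u G : i \notin G -> j \notin G ->
  pullback u (i |: G) = pos_sign K i G * pos_sign K j G * u (j |: G).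
Proof.
move=> iG jG; rewrite /pullback [LHS]ffunE interior_wedge1_same setU11 add0r.
rewrite ffunE setU11 setU1K // ffunE (negbTE jG) interior_wedge1_same !inE (negbTE ij).
by rewrite (negbTE iG) pos_signU1 // ltnn mul1r mulrA.
Qed.

(** The coefficient of e_i /\ e_j, read in the face ring of the link when [Z] is a layer of the
    link. *)
Definition edge_coef Z u : E := restrict Z (interior j (interior i u)).

Lemma edge_coef_is_linear Z : linear (edge_coef Z).
Proof. by move=> c u v; rewrite /edge_coef !linearP. Qed.

HB.instance Definition _ Z :=
  GRing.isLinear.Build K E E *:%R (edge_coef Z) (edge_coef_is_linear Z).

Lemma edge_coefE Z u G : G \in Z -> i \notin G -> j \notin G ->
  edge_coef Z u G = pos_sign K j G * (pos_sign K i (j |: G) * u (i |: (j |: G))).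
Proof.
by move=> GZ iG jG; rewrite !ffunE GZ (negbTE jG) !inE (negbTE ij) (negbTE iG).
Qed.

(** A left inverse of the pullback on the face ring of the contraction: a face also in [X] is read
    directly, a new face F at the set [i |: (F :\ j)] that it came from. *)
Definition recover X Y u : E :=
  restrict (Y :&: X) u + restrict (Y :\: X) (wedge1 j (interior i u)).

Lemma recover_is_linear X Y : linear (recover X Y).
Proof. by move=> c u v; rewrite /recover !linearP scalerDr; apply: addrACA. Qed.

HB.instance Definition _ X Y :=
  GRing.isLinear.Build K E E *:%R (recover X Y) (recover_is_linear X Y).

Section Step.
Variables X Y Z : {set {set 'I_n}}.
Hypothesis Yi : forall F, F \in Y -> i \notin F.
Hypothesis YX : forall F, F \in Y -> F \in X \/ (j \in F /\ i |: (F :\ j) \in X).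
Hypothesis Zij : forall G, G \in Z -> [/\ i \notin G, j \notin G & i |: (j |: G) \in X].

Lemma recover_pullback u : recover X Y (restrict X (pullback u)) = restrict Y u.
Proof.
apply/ffunP => F; rewrite /recover /= [LHS]ffunE.
rewrite [X in X + _ = _]ffunE [X in _ + X = _]ffunE [RHS]ffunE !inE.
case FY: (F \in Y); last by rewrite !andbF addr0.
have iF := Yi FY; case FX: (F \in X); first by rewrite addr0 ffunE FX pullback_out.
case: (YX FY) => [|[jF FX']]; first by rewrite FX.
rewrite add0r /= ffunE jF ffunE !inE (negbTE iF) andbF ffunE FX' pullback_edge ?setD11 //; last first.
  by rewrite !inE (negbTE iF) andbF.
rewrite setD1K // [pos_sign K j (F :\ j)]pos_signD1 // ltnn mul1r.
set a := pos_sign K i _; set c := pos_sign K j F.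
rewrite mulrA -[a * c]mulrC !mulrA -[c * a * c]mulrA [a * c]mulrC mulrA pos_sign_sqr mul1r.
by rewrite pos_sign_sqr mul1r.
Qed.

(** [X], [Y], [Z] stand for layers of the complex, of the contraction, and of the link two degrees
    lower. The pullback is injective on the face ring of the contraction by [recover], and its
    values have no e_i /\ e_j term, so [rank2_ker] adds the two ranks. *)
Lemma rank2_contraction f w1 w2 :
  (rank2 (restrict Y \o wedges f w1) (restrict Y \o wedges f w2) +
   rank2 (edge_coef Z \o wedges (pull_forms f) w1) (edge_coef Z \o wedges (pull_forms f) w2)
   <= rank2 (restrict X \o wedges (pull_forms f) w1)
            (restrict X \o wedges (pull_forms f) w2))%N.
Proof.
have bX u : edge_coef Z (restrict X u) = edge_coef Z u.
  apply/ffunP => G; have [GZ|GZ] := boolP (G \in Z); last first.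
    by rewrite !ffunE (negbTE GZ).
  by have [iG jG GX] := Zij GZ; rewrite !edge_coefE // ffunE GX.
have bP u : edge_coef Z (pullback u) = 0.
  apply/ffunP => G; have [GZ|GZ] := boolP (G \in Z); last first.
    by rewrite !ffunE (negbTE GZ).
  have [iG jG _] := Zij GZ; rewrite edge_coefE // pullback_both ?setU11 ?ffunE ?mulr0 //.
  by rewrite !inE eqxx orbT.
apply: leq_trans (@rank2_ker _ _ (edge_coef Z) (restrict X \o (pullback \o wedges f w1))
  (restrict X \o (pullback \o wedges f w2)) _ _ _ _ _ _).
- apply: leq_add.
    rewrite (@rank2_eq _ _ (restrict Y \o wedges f w1) (recover X Y \o (restrict X \o (pullback \o wedges f w1)))
      (restrict Y \o wedges f w2) (recover X Y \o (restrict X \o (pullback \o wedges f w2)))).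
    + exact: rank2_comp.
    + by move=> u; rewrite /= -recover_pullback.
    + by move=> u; rewrite /= -recover_pullback.
  rewrite (@rank2_eq _ _ (edge_coef Z \o wedges (pull_forms f) w1)
    (edge_coef Z \o (restrict X \o wedges (pull_forms f) w1)) (edge_coef Z \o wedges (pull_forms f) w2)
    (edge_coef Z \o (restrict X \o wedges (pull_forms f) w2))) // => u /=; exact/esym/bX.
- by move=> u; exists (pullback u), 0; rewrite linear0 addr0 /= pullback_wedges.
- by move=> u; exists 0, (pullback u); rewrite linear0 add0r /= pullback_wedges.
- by move=> u; rewrite /= bX bP.
- by move=> u; rewrite /= bX bP.
Qed.

Lemma wedges_local f g w u G : (forall l k, k \in G -> f l k = g l k) ->
  wedges f w u G = wedges g w u G.
Proof.
elim: w G => //= l w IH G fg; rewrite !wedgeE; apply: eq_bigr => k kG.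
by rewrite fg // IH // => m h; rewrite inE => /andP[_ hG]; apply: fg.
Qed.

(** Specialises y_0 to e_j and shifts the forms of the link by one; pulling back then turns y_0 into
    e_i + e_j. *)
Definition link_forms f : nat -> 'I_n -> K :=
  fun l => if l is l'.+1 then f l' else coord_form K j.

Lemma edge_coef_link f w u : exists v,
  restrict Z (wedges f w u) =
  edge_coef Z (wedges (pull_forms (link_forms f)) (0%N :: map S w) v).
Proof.
(* Moving e_j past the forms of [w] produces the sign, and (e_i + e_j) /\ e_j = e_i /\ e_j. *)
exists ((-1) ^+ size w *: wedge (coord_form K j) u).
have -> : wedges (pull_forms (link_forms f)) (0%N :: map S w)
    ((-1) ^+ size w *: wedge (coord_form K j) u) =
    wedge1 i (wedge1 j (wedges (pull_forms f) w u)).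
  have e v : wedges (pull_forms (link_forms f)) (map S w) v = wedges (pull_forms f) w v.
    by elim: w => //= l w ->.
  rewrite [LHS]/= e linearZ /= -wedge_wedges wedge_coord.
  rewrite /wedge (bigD1 i) //= (bigD1 j) 1?eq_sym //= big1 => [|k /andP[ki kj]].
    rewrite addr0 /pull_forms /pull_form /= eqxx [j == i]eq_sym (negbTE ij) /coord_form eqxx.
    by rewrite !scale1r wedge1_sqr addr0.
  by rewrite /pull_forms /pull_form /= (negbTE ki) /coord_form (negbTE kj) scale0r.
apply/ffunP => G; have [GZ|GZ] := boolP (G \in Z); last by rewrite !ffunE (negbTE GZ).
have [iG jG _] := Zij GZ; rewrite edge_coefE // ffunE GZ ffunE setU11 setU1K; last first.
  by rewrite !inE (negbTE ij).
rewrite ffunE setU11 setU1K // !pos_signU1 ?inE ?negb_or ?ij ?iG // !ltnn !mul1r.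
rewrite -pos_signU1 // [X in _ * X]mulrA pos_sign_sqr mul1r mulrA pos_sign_sqr mul1r.
(* The pulled-back forms differ from [f] only at i, which is not in G. *)
by apply: wedges_local => l k kG; rewrite /pull_forms /pull_form; case: eqP => // e; rewrite -e kG in iG.
Qed.

Lemma rank2_link f w1 w2 :
  (rank2 (restrict Z \o wedges f w1) (restrict Z \o wedges f w2) <=
   rank2 (edge_coef Z \o wedges (pull_forms (link_forms f)) (0%N :: map S w1))
         (edge_coef Z \o wedges (pull_forms (link_forms f)) (0%N :: map S w2)))%N.
Proof.
apply: rank2_le => u.
  by have [v e] := edge_coef_link f w1 u; exists v, 0; rewrite linear0 addr0 /= e.
by have [v e] := edge_coef_link f w2 u; exists 0, v; rewrite linear0 add0r /= e.
Qed.

End Step.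

End ContractionRank.

(** * Face numbers of contractions *)

Section Combinatorics.
Variable n : nat.
Implicit Types (C X : {set {set 'I_n}}) (F G V : {set 'I_n}) (i j : 'I_n).

Definition layer X s : {set {set 'I_n}} := [set F in X | #|F| == s].

Lemma in_link2 C i j G :
  (G \in link C [set i; j]) = [&& i \notin G, j \notin G & i |: (j |: G) \in C].
Proof.
rewrite inE disjoint_sym disjoints_subset subUset !sub1set !in_setC -andbA.
by rewrite setUC -setUA.
Qed.

Lemma in_link1 C i G : (G \in link C [set i]) = (i \notin G) && (i |: G \in C).
Proof. by rewrite inE disjoint_sym disjoints1 setUC. Qed.

Lemma cardsU1_notin i G : i \notin G -> #|i |: G| = #|G|.+1.
Proof. by move=> iG; rewrite cardsU1 iG. Qed.

(** For the weight t^s this is f_C(t) = f_D(t) + t (1 + t) f_L(t). Each face G of the link accounts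
    for two lost faces: one of size |G| + 2 containing the edge, and one of size |G| + 1 whose image
    under the swap of i for j was already a face. *)
Lemma contraction_weight C i j (g : nat -> int) :
    subset_closed C -> i != j -> link_condition C i j ->
  \sum_(F in C) g #|F| = \sum_(F in contraction C i j) g #|F| +
    \sum_(G in link C [set i; j]) (g #|G|.+1 + g #|G|.+2).
Proof.
move=> [_ sub] ij lkC; set lk := link C [set i; j].
pose X1 := [set F in C | i \notin F].
pose A := [set F in C | (i \in F) && (j \notin F)].
pose B := [set F in C | (i \in F) && (j \in F)].
pose swap F := j |: (F :\ i).
have sumC : \sum_(F in C) g #|F| =
    \sum_(F in X1) g #|F| + \sum_(F in A) g #|F| + \sum_(F in B) g #|F|.
  rewrite (bigID (fun F => i \notin F)) /= -addrA; congr (_ + _).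
    by apply: eq_bigl => F; rewrite inE.
  rewrite (bigID (fun F => j \notin F)) /=; congr (_ + _); apply: eq_bigl => F.
    by rewrite !inE negbK andbA.
  by rewrite !inE !negbK andbA.
have sumB : \sum_(F in B) g #|F| = \sum_(G in lk) g #|G|.+2.
  have -> : B = [set i |: (j |: G) | G in lk].
    apply/setP => F; apply/idP/imsetP => [|[G]].
      rewrite inE => /and3P[FC iF jF]; exists (F :\ i :\ j).
        rewrite in_link2 !inE !eqxx /= andbF /= setD1K ?setD1K // !inE 1?eq_sym ij jF //.
      by rewrite setD1K ?setD1K // !inE eq_sym ij jF.
    rewrite in_link2 => /and3P[iG jG GC ->]; rewrite !inE GC !eqxx orbT //.
  rewrite big_imset /=; last first.
    move=> G H; rewrite !in_link2 => /and3P[iG jG _] /and3P[iH jH _] e.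
    have: (i |: (j |: G)) :\ i :\ j = (i |: (j |: H)) :\ i :\ j by rewrite e.
    by rewrite !setU1K // !inE negb_or ij.
  apply: eq_bigr => G; rewrite in_link2 => /and3P[iG jG _].
  by rewrite !cardsU1_notin // !inE negb_or ij.
have swap_inj : {in A &, injective swap}.
  move=> F G; rewrite !inE => /and3P[_ iF jF] /and3P[_ iG jG] e.
  have: swap F :\ j = swap G :\ j by rewrite e.
  rewrite /swap !setU1K ?inE ?(negbTE jF) ?(negbTE jG) ?andbF // => {}e.
  by rewrite -(setD1K iF) e setD1K.
have swap_card F : F \in A -> #|swap F| = #|F|.
  rewrite !inE => /and3P[_ iF jF]; rewrite cardsU1_notin ?inE ?(negbTE jF) ?andbF //.
  by rewrite (cardsD1 i F) iF.
(* A face containing both i and j collapses onto [F :\ i], which is already in [X1]. *)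
have cE : contraction C i j = X1 :|: swap @: A.
  apply/setP => F; rewrite !inE; apply/orP/orP => -[h|/imsetP[G]]; try by left.
    rewrite inE => /andP[GC iG] ->; case jG: (j \in G).
      left; rewrite !inE eqxx (negbTE ij) /= andbT; apply: sub GC _.
      by rewrite subUset sub1set jG subD1set.
    by right; apply/imsetP; exists G; rewrite // !inE GC iG jG.
  by rewrite !inE => /and3P[GC iG jG] ->; right; apply/imsetP; exists G; rewrite // inE GC.
(* If swapping i for j gives a face of [C], the remaining set lies in the links of both i and j,
   hence in the link of the edge by the Link condition. *)
have sumcap : \sum_(F in swap @: A :&: X1) g #|F| = \sum_(G in lk) g #|G|.+1.
  have -> : swap @: A :&: X1 = [set j |: G | G in lk].
    apply/setP => F; apply/idP/imsetP => [|[G]].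
      rewrite inE => /andP[/imsetP[G]]; rewrite !inE => /and3P[GC iG jG] -> /andP[FC _].
      exists (G :\ i) => //; rewrite /lk -lkC !inE.
      have := in_link1 C i (G :\ i); rewrite inE => ->.
      have := in_link1 C j (G :\ i); rewrite inE => ->.
      by rewrite !inE eqxx setD1K // GC (negbTE jG) andbF FC.
    rewrite in_link2 => /and3P[iG jG GC] ->; rewrite inE; apply/andP; split; last first.
      rewrite !inE (negbTE ij) iG andbT; apply: sub GC _.
      by apply/subsetP => k; rewrite !inE => ->; rewrite orbT.
    apply/imsetP; exists (i |: G); last by rewrite /swap setU1K.
    rewrite !inE eqxx eq_sym (negbTE ij) (negbTE jG) /= andbT.
    by apply: sub GC _; apply: setUS; apply: subsetUr.
  rewrite big_imset /=; last first.
    move=> G H; rewrite !in_link2 => /and3P[_ jG _] /and3P[_ jH _] e.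
    by rewrite -(setU1K jG) e setU1K.
  by apply: eq_bigr => G; rewrite in_link2 => /and3P[_ jG _]; rewrite cardsU1_notin.
have sumA : \sum_(F in A) g #|F| = \sum_(F in swap @: A) g #|F|.
  by rewrite big_imset //=; apply: eq_bigr => F FA; rewrite swap_card.
rewrite sumC sumB sumA cE [X in _ + X + _](big_setID X1) /= sumcap big_split /=.
rewrite [X in _ = X + _](big_setID X1) /= setUK setDUl setDv set0U.
set a := \sum_(F in X1) _; set b := \sum_(G in lk) _; set c := \sum_(F in _ :\: _) _.
by rewrite [b + c]addrC !addrA.
Qed.

(** Minus the reduced Euler characteristic. That it does not vanish is used to show that contracting
    an edge keeps the dimension. *)
Definition euler X : int := \sum_(F in X) (-1) ^+ #|F|.

(** Adding or removing i pairs the sets of [X] with opposite signs. *)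
Lemma euler_cone X i :
  (forall F, F \in X -> i |: F \in X) -> (forall F, F \in X -> F :\ i \in X) ->
  euler X = 0.
Proof.
move=> XU XD; rewrite /euler (bigID (fun F => i \in F)) /=.
rewrite (reindex_onto (fun F => i |: F) (fun F => F :\ i)) => [|F /andP[_ iF]]; last exact: setD1K.
rewrite addrC; apply/eqP; rewrite addr_eq0 -sumrN; apply/eqP.
apply: eq_big => [F|F /andP[_ iF]]; last by rewrite cardsU1_notin // exprS mulN1r opprK.
rewrite setU11 andbT; apply/andP/andP => [[FX iF]|[FX /eqP e]].
  by rewrite XU // setU1K.
have iF : i \notin F by rewrite -e setD11.
by split=> //; rewrite -e XD.
Qed.

Lemma euler_contraction C i j :
    subset_closed C -> i != j -> link_condition C i j ->
  euler C = euler (contraction C i j).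
Proof.
move=> sC ij lC; rewrite /euler (contraction_weight (fun s => (-1) ^+ s) sC ij lC).
by rewrite [X in _ + X]big1 ?addr0 // => G _; rewrite [_ ^+ _.+2]exprS mulN1r subrr.
Qed.

(** Contraction preserves [euler], since the link terms of sizes |G| + 1 and |G| + 2 cancel. A full
    simplex is a cone, so its boundary has value 1 or -1. *)
Lemma euler_neq0 C : strongly_edge_decomposable C -> euler C != 0.
Proof.
elim=> [|V V0|D i j sC pC ij eC lC _ IH _ _].
- by rewrite /euler big_set1 cards0.
- have [i iV] := set0Pn _ V0.
  have : euler (powerset V) = 0.
    apply: (@euler_cone _ i) => F; rewrite !inE => FV.
      by rewrite subUset sub1set iV.
    by apply: subset_trans FV; apply: subD1set.
  rewrite /euler (bigD1 V) ?inE //= => /eqP; rewrite addrC addr_eq0 => /eqP e.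
  have -> : \sum_(F in simplex_boundary V) (-1) ^+ #|F| =
      \sum_(F in powerset V | F != V) (-1) ^+ #|F| :> int.
    by apply: eq_bigl => F; rewrite !inE properEneq andbC.
  by rewrite e oppr_eq0 signr_eq0.
- by rewrite (euler_contraction sC _ lC) // neq_ltn ij.
Qed.

Definition has_dim C d := (forall F, F \in C -> (#|F| <= d)%N) /\ exists2 F, F \in C & #|F| = d.

Lemma has_dim_dimS C : finset.set0 \in C -> has_dim C (dimS C).
Proof.
move=> C0; split=> [F FC|]; first exact: (leq_bigmax_cond (F := fun F => #|F|)).
have C_gt0 : (0 < #|C|)%N by apply/card_gt0P; exists set0.
by have [F FC e] := eq_bigmax_cond (fun F : {set 'I_n} => #|F|) C_gt0; exists F.
Qed.

Lemma pure_extend C d F : pure C -> has_dim C d -> F \in C ->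
  exists2 H : {set 'I_n}, F \subset H & H \in C /\ #|H| = d.
Proof.
move=> pC [le [M MC Md]] FC.
have [H mH FH] := maxset_exists (P := fun G => G \in C) FC.
exists H => //; have HC : H \in C by case/maxsetP: mH.
split=> //; rewrite -Md; apply: (pC _ _ mH); apply/maxsetP; split=> // G GC MG.
by apply/eqP; rewrite eq_sym eqEcard MG Md le.
Qed.

(** Otherwise every face of size d contains i, so by purity [C] is a cone with apex i, against the
    nonzero Euler characteristic. *)
Lemma contraction_dim C i j d :
    subset_closed C -> pure C -> i != j -> euler C != 0 -> has_dim C d ->
  has_dim (contraction C i j) d.
Proof.
move=> [_ sub] pC ij eC dC; have [le _] := dC; split=> [F|].
  rewrite inE => /orP[|/imsetP[G]]; rewrite inE => /andP[FC iF]; first exact: le.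
  move=> ->; apply: leq_trans (le _ FC); rewrite cardsU1 (cardsD1 i G) iF leq_add2r.
  exact: leq_b1.
apply: contrapT => no; case/eqP: eC; apply: (@euler_cone _ i) => F FC; last first.
  by apply: sub FC _; apply: subD1set.
have [H FH [HC Hd]] := pure_extend pC dC FC.
have iH : i \in H.
  apply: contrapT => /negP iH; apply: no; exists H => //.
  by rewrite !inE HC iH.
by apply: sub HC _; rewrite subUset sub1set iH.
Qed.

Lemma link_dim C i j d :
    pure C -> i != j -> [set i; j] \in C -> has_dim C d ->
  exists2 e, d = e.+2 & has_dim (link C [set i; j]) e.
Proof.
move=> pC ij eC dC; have [le _] := dC.
have [H ijH [HC Hd]] := pure_extend pC dC eC.
have iH : i \in H by apply: (subsetP ijH); rewrite !inE eqxx.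
have jH : j \in H by apply: (subsetP ijH); rewrite !inE eqxx orbT.
have jHi : j \in H :\ i by rewrite !inE eq_sym ij.
exists #|H :\ i :\ j|; first by rewrite -Hd (cardsD1 i H) iH (cardsD1 j (H :\ i)) jHi.
split=> [G|].
  rewrite in_link2 => /and3P[iG jG /le].
  by rewrite !cardsU1_notin ?inE ?negb_or ?ij // -Hd (cardsD1 i H) iH (cardsD1 j (H :\ i)) jHi.
exists (H :\ i :\ j) => //; rewrite in_link2 !inE !eqxx /= andbF /=.
by rewrite [j |: _]setD1K // setD1K.
Qed.

Definition cnt X s : int := #|layer X s|%:Z.

Lemma cntE X s : cnt X s = \sum_(F in X) (#|F| == s)%:R.
Proof.
rewrite /cnt -sum1_card -natz natr_sum [RHS]big_mkcond [LHS]big_mkcond /=.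
by apply: eq_bigr => F _; rewrite inE; case: (F \in X); case: eqP.
Qed.

Definition cnt_pred X s : int := if s is s'.+1 then cnt X s' else 0.

Lemma cnt_contraction C i j s :
    subset_closed C -> i != j -> link_condition C i j ->
  cnt C s = cnt (contraction C i j) s +
    (cnt_pred (link C [set i; j]) s + (if s is s'.+1 then cnt_pred (link C [set i; j]) s' else 0)).
Proof.
move=> sC ij lC; rewrite !cntE (contraction_weight (fun k => (k == s)%:R) sC ij lC).
congr (_ + _); rewrite big_split; congr (_ + _).
  case: s => [|s] /=; first by rewrite big1.
  by rewrite cntE.
by case: s => [|[|s]] /=; [rewrite big1|rewrite big1|rewrite cntE].
Qed.

(* The coefficients of t^m / (1 + t)^m * \sum_s g s * t^s: the expected dimension
   of the degree-s part of K{C} multiplied by m generic linear forms. *)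
Fixpoint rho (g : nat -> int) m : nat -> int :=
  if m is m'.+1 then
    fix rho_m s := if s is s'.+1 then rho g m' s' - rho_m s' else 0
  else g.

Lemma rho0 g s : rho g 0 s = g s. Proof. by []. Qed.
Lemma rhoS0 g m : rho g m.+1 0 = 0. Proof. by []. Qed.
Lemma rhoSS g m s : rho g m.+1 s.+1 = rho g m s - rho g m.+1 s. Proof. by []. Qed.

Lemma rhoD (g h : nat -> int) m s : rho (fun k => g k + h k) m s = rho g m s + rho h m s.
Proof.
elim: m s => [//|m IH]; elim=> [|s IHs]; first by rewrite !rhoS0.
by rewrite !rhoSS IH IHs; ring.
Qed.

Lemma eq_rho g h m s : g =1 h -> rho g m s = rho h m s.
Proof.
by move=> gh; elim: m s => [//|m IH]; elim=> [//|s IHs]; rewrite !rhoSS IH IHs.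
Qed.

Lemma rho_small g m s : (s < m)%N -> rho g m s = 0.
Proof.
elim: m s => [//|m IH]; elim=> [//|s IHs] sm.
by rewrite rhoSS IH // IHs ?subrr // ltnW.
Qed.

(* Multiplying the generating function by t (1 + t) shifts [rho] diagonally. *)
Lemma rho_shift (g h : nat -> int) : h 0%N = 0 -> h 1%N = g 0%N ->
    (forall s, h s.+2 = g s.+1 + g s) ->
  forall m s, rho h m.+1 s.+2 = rho g m s.
Proof.
move=> h0 h1 h2; elim=> [|m IH]; elim=> [|s IHs].
- by rewrite !rhoSS !rhoS0 !rho0 h0 h1; ring.
- by rewrite rhoSS IHs !rho0 h2; ring.
- by rewrite !rhoSS !rhoS0 !subr0; case: {IH} m => [|m]; rewrite ?rho0 ?rhoS0.
- by rewrite rhoSS IHs IH rhoSS.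
Qed.

Lemma rho_contraction C i j :
    subset_closed C -> i != j -> link_condition C i j ->
  forall m s, rho (cnt C) m.+1 s.+2 =
    rho (cnt (contraction C i j)) m.+1 s.+2 + rho (cnt (link C [set i; j])) m s.
Proof.
move=> sC ij lC m s; set h := (fun s => cnt_pred (link C [set i; j]) s +
  (if s is s'.+1 then cnt_pred (link C [set i; j]) s' else 0)).
rewrite (eq_rho _ _ (fun s => cnt_contraction s sC ij lC)) rhoD; congr (_ + _).
by apply: rho_shift => //=; rewrite addr0.
Qed.

Lemma rho_contraction_small C i j m s :
    subset_closed C -> i != j -> link_condition C i j -> (s < 2)%N ->
  rho (cnt C) m.+1 s = rho (cnt (contraction C i j)) m.+1 s.
Proof.
move=> sC ij lC; case: s => [//|[|//]] _.
rewrite !rhoSS !rhoS0; case: m => [|m]; last by rewrite !rhoS0.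
by rewrite !rho0 (cnt_contraction _ sC ij lC) /= addr0.
Qed.

End Combinatorics.

(** * Lower bounds for the ranks *)

Section RankBounds.
Variables (K : fieldType) (n : nat).
Hypothesis K_infinite : infinite_set [set: K]%classic.
Local Notation E := {ffun {set 'I_n} -> K^o}.
Implicit Types (C X : {set {set 'I_n}}) (F G V : {set 'I_n}) (i j : 'I_n).
Implicit Types (f : nat -> 'I_n -> K).

Definition form_curve (g : K -> nat -> 'I_n -> K) : Prop :=
  forall l i, exists p : {poly K}, forall t, g t l i = p.[t].

Lemma form_curve_join f f' : exists g, [/\ form_curve g, g 0 = f & g 1 = f'].
Proof.
exists (fun t l i => f l i + t * (f' l i - f l i)); split.
- by move=> l i; exists ((f l i)%:P + 'X * (f' l i - f l i)%:P) => t; rewrite !hornerE.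
- by apply/funext => l; apply/funext => i; rewrite mul0r addr0.
- by apply/funext => l; apply/funext => i; rewrite mul1r addrC subrK.
Qed.

Lemma form_curve_coord l i : curve_poly form_curve (fun f => f l i).
Proof. by move=> g /(_ l i). Qed.

(** For [X] the faces of size s this is the dimension in degree s of the ideal of the face ring
    generated by the products along [w1] and [w2]. *)
Definition forms_rank X w1 w2 f : nat :=
  rank2 (restrict X \o wedges f w1) (restrict X \o wedges f w2).

Lemma rank2_curve_open (p : {linear E -> E}) (q : (nat -> 'I_n -> K) -> (nat -> 'I_n -> K))
    w1 w2 (r : int) :
    (forall l i, curve_poly form_curve (fun f => q f l i)) ->
  curve_open form_curve
    (fun f => r <= (rank2 (p \o wedges (q f) w1) (p \o wedges (q f) w2))%:Z).
Proof.
move=> lq f0 rf0.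
have lw w u F : curve_poly form_curve (fun f => p (wedges (q f) w u) F).
  apply: (linear_fun_ring (curve_poly_ring form_curve) p (g := fun f => wedges (q f) w u)) => G.
  exact: (wedges_fun_ring (curve_poly_ring form_curve)).
have [||h [lh h0 hh]] := @rank2_lower_semicontinuous _ _ _ _ (curve_poly_ring form_curve)
  (fun f => p \o wedges (q f) w1) (fun f => p \o wedges (q f) w2) _ _ f0.
- exact: lw.
- exact: lw.
exists h; split=> // f /hh le; apply: le_trans rf0 _.
by rewrite lez_nat.
Qed.

Lemma forms_rank_generic X w1 w2 r : (exists f, r <= (forms_rank X w1 w2 f)%:Z) ->
  generic form_curve (fun f => r <= (forms_rank X w1 w2 f)%:Z).
Proof.
move=> ex; split=> //; apply: (@rank2_curve_open _ id) => l i; exact: form_curve_coord.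
Qed.

(** Used where the forms are controlled only up to nonzero factors, namely when an adjugate matrix
    replaces an inverse. *)
Lemma forms_rank_scale X w1 w2 f (c : nat -> K) :
    (forall l, c l != 0) ->
  (forms_rank X w1 w2 f <= forms_rank X w1 w2 (fun l i => (c l * f l i)%R))%N.
Proof.
move=> c0.
have wE w u : wedges f w u = wedges (fun l i => c l * f l i) w ((\prod_(l <- w) c l)^-1 *: u).
  elim: w => [|l w IH]; first by rewrite big_nil invr1 scale1r.
  rewrite big_cons /= IH invfM -scalerA; set x := _ *: u.
  rewrite [wedges _ _ (_ *: x)]linearZ /= [wedge _ (_ *: _)]linearZ /=.
  rewrite /wedge scaler_sumr; apply: eq_bigr => i _; rewrite scalerA mulrA mulVf ?mul1r //.
apply: rank2_le => u; [eexists; exists 0|exists 0; eexists]; rewrite linear0 ?addr0 ?add0r /=;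
  by rewrite wE.
Qed.

Section Contraction.
Variables (i j : 'I_n) (X Y Z : {set {set 'I_n}}).
Hypothesis ij : i != j.
Hypothesis Yi : forall F, F \in Y -> i \notin F.
Hypothesis YX : forall F, F \in Y -> F \in X \/ (j \in F /\ i |: (F :\ j) \in X).
Hypothesis Zij : forall G, G \in Z -> [/\ i \notin G, j \notin G & i |: (j |: G) \in X].

Definition edge_rank w1 w2 f : nat :=
  rank2 (edge_coef i j Z \o wedges (pull_forms i j f) w1)
        (edge_coef i j Z \o wedges (pull_forms i j f) w2).

(** Both bounds hold on nonempty open sets of forms, so one [f] satisfies both; its pulled-back
    forms then work for [X]. *)
Lemma forms_rank_contraction w1 w2 r1 r2 :
    (exists f, r1 <= (forms_rank Y w1 w2 f)%:Z) ->
    (exists f, r2 <= (edge_rank w1 w2 f)%:Z) ->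
  exists f, r1 + r2 <= (forms_rank X w1 w2 f)%:Z.
Proof.
move=> e1 e2.
have g2 : generic form_curve (fun f => r2 <= (edge_rank w1 w2 f)%:Z).
  split=> //; apply: (@rank2_curve_open _ (pull_forms i j)) => l k; rewrite /pull_forms /pull_form.
  by case: (k == i); apply: form_curve_coord.
have [_ [f [le1 le2]]] := generic_and K_infinite form_curve_join
  (forms_rank_generic e1) g2.
exists (pull_forms i j f); apply: le_trans (lerD le1 le2) _.
rewrite -PoszD lez_nat; exact: rank2_contraction.
Qed.

Lemma edge_rank_link w1 w2 r : (exists f, r <= (forms_rank Z w1 w2 f)%:Z) ->
  exists f, r <= (edge_rank (0%N :: map S w1) (0%N :: map S w2) f)%:Z.
Proof.
move=> [f le]; exists (link_forms j f); apply: le_trans le _; rewrite lez_nat.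
exact: (rank2_link ij Zij).
Qed.

End Contraction.

Lemma layer_contraction C i j s : i != j -> forall F, F \in layer (contraction C i j) s ->
  i \notin F /\ (subset_closed C -> F \in layer C s \/ (j \in F /\ i |: (F :\ j) \in layer C s)).
Proof.
move=> ij F; rewrite inE => /andP[Fc Fs]; move: Fc; rewrite inE => /orP[|/imsetP[G]].
  by rewrite inE => /andP[FC iF]; split=> // _; left; rewrite inE FC.
rewrite inE => /andP[GC iG] FE; split; first by rewrite FE !inE (negbTE ij) eqxx.
move=> [_ sub]; case jG: (j \in G).
  left; rewrite inE Fs andbT FE; apply: sub GC _.
  by rewrite subUset sub1set jG subD1set.
have jD : j \notin G :\ i by rewrite !inE jG andbF.
right; rewrite FE setU11 setU1K // setD1K //; split=> //.
rewrite inE GC /= -(eqP Fs) FE cardsU1_notin //.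
by rewrite (cardsD1 i G) iG.
Qed.

Lemma layer_link C i j s G : i != j -> G \in layer (link C [set i; j]) s ->
  [/\ i \notin G, j \notin G & i |: (j |: G) \in layer C s.+2].
Proof.
move=> ij; rewrite inE in_link2 => /andP[/and3P[iG jG GC] /eqP Gs]; split=> //.
have ijG : i \notin j |: G by rewrite !inE negb_or ij.
by rewrite inE GC !cardsU1_notin // Gs eqxx.
Qed.

(** A monomial divisible by one of the two products of coordinate vectors lies in the ideal, and
    distinct monomials are independent. *)
Lemma forms_rank_coord X w1 w2 (v : nat -> 'I_n) :
    uniq (map v w1) -> uniq (map v w2) ->
  (#|[set F in X | all (mem F) (map v w1) || all (mem F) (map v w2)]| <=
   forms_rank X w1 w2 (fun l => coord_form K (v l)))%N.
Proof.
move=> u1 u2; apply: rank2_ge_card => F; rewrite inE => /andP[FX Fw].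
have rF : restrict X (mono K F) = mono K F.
  apply/ffunP => G; rewrite [LHS]ffunE !monoE; case: ifP => // GX.
  by case: eqP => // GF; rewrite GF FX in GX.
have aux w : uniq (map v w) -> all (mem F) (map v w) ->
    exists y, mono K F = restrict X (wedges (fun l => coord_form K (v l)) w y).
  move=> uw /allP Fall.
  have [||y e] := @wedges_coord_supp K n _ (fun l => coord_form K (v l)) v w (mono K F) _ uw.
  - by move=> l _ u; apply: wedge_coord.
  - by move=> G; rewrite monoE; case: (eqVneq G F) => [-> _|]; rewrite ?eqxx.
  by exists y; rewrite -e.
case/orP: Fw => [/(aux _ u1)|/(aux _ u2)] [y e].
  by exists y, 0; rewrite linear0 addr0.
by exists 0, y; rewrite linear0 add0r.
Qed.

(** * Boundaries of simplices with coordinate forms *)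

Section Simplex.
Variables (V : {set 'I_n}) (d : nat) (v : nat -> 'I_n).
Hypothesis Vd : #|V| = d.+1.
Hypothesis v_inj : {in [pred l | l < d.+1]%N &, injective v}.
Hypothesis vV : forall l, (l < d.+1)%N -> v l \in V.

Definition simplex_layer m s : {set {set 'I_n}} :=
  [set F in layer (simplex_boundary V) s | all (mem F) (map v (iota 0 m))].

Lemma in_simplex_layer m s F : (s <= d)%N ->
  (F \in simplex_layer m s) = [&& F \subset V, #|F| == s & all (mem F) (map v (iota 0 m))].
Proof.
move=> sd; rewrite !inE properEcard -!andbA; case: (F \subset V) => //=.
by case: eqP => [->|]; rewrite ?andbF //= Vd ltnS sd.
Qed.

Lemma all_iotaS m F : all (mem F) (map v (iota 0 m.+1)) =
  all (mem F) (map v (iota 0 m)) && (v m \in F).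
Proof. by rewrite -addn1 iotaD map_cat all_cat /= andbT. Qed.

(** Adding v_m is a bijection from the sets missing v_m; s < d keeps the enlarged set a proper
    subset of [V]. This is the recursion defining [rho]. *)
Lemma simplex_layer_rec m s : (m <= d)%N -> (s < d)%N ->
  (#|simplex_layer m s| = #|simplex_layer m.+1 s| + #|simplex_layer m.+1 s.+1|)%N.
Proof.
move=> md sd; rewrite -(cardsID [set F : {set 'I_n} | v m \in F] (simplex_layer m s)).
congr (_ + _)%N.
  by apply: eq_card => F; rewrite inE !in_simplex_layer 1?ltnW // all_iotaS inE !andbA.
have vm_inj : {in simplex_layer m s :\: [set F : {set 'I_n} | v m \in F] &,
    injective (fun F => v m |: F)}.
  move=> F G; rewrite !inE => /andP[mF _] /andP[mG _] e.
  by rewrite -(setU1K mF) e setU1K.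
rewrite -(card_in_imset vm_inj); apply: eq_card => F; apply/imsetP/idP => [[G]|].
  rewrite in_setD in_set (in_simplex_layer _ _ (ltnW sd)) => /and4P[mG GV /eqP Gs Gall] ->.
  rewrite in_simplex_layer // subUset sub1set vV // GV cardsU1_notin // Gs eqxx.
  rewrite all_iotaS setU11 /= andbT; apply/allP => x xw; rewrite inE /=.
  by apply/setU1P; right; apply: (allP Gall).
rewrite in_simplex_layer // all_iotaS => /and4P[FV /eqP Fs Fall mF].
exists (F :\ v m); last by rewrite setD1K.
rewrite inE in_simplex_layer 1?ltnW // inE setD11 /= (subset_trans (subD1set _ _) FV).
rewrite (cardsD1 (v m)) mF add1n in Fs; case: Fs => ->; rewrite eqxx /=.
apply/allP => x /mapP[l]; rewrite mem_iota /= add0n => lm ->; rewrite !inE.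
apply/andP; split; last by apply: (allP Fall); rewrite map_f // mem_iota.
by apply/eqP => e; have : l = m; [apply: v_inj e; rewrite inE; lia|lia].
Qed.

Lemma rho_simplex m s : (m <= d.+1)%N -> (s <= d)%N ->
  rho (cnt (simplex_boundary V)) m s = #|simplex_layer m s|%:Z.
Proof.
elim: m s => [|m IH] s.
  by move=> _ _; rewrite rho0; congr Posz; apply: eq_card => F; rewrite !inE andbT.
move=> md; elim: s => [|s IHs] sd.
  rewrite rhoS0; apply/esym/eqP; rewrite eqz_nat cards_eq0 -subset0.
  apply/subsetP => F; rewrite in_simplex_layer // cards_eq0 all_iotaS.
  by case/and4P=> _ /eqP-> _; rewrite inE.
rewrite rhoSS IHs 1?ltnW // IH 1?ltnW // (simplex_layer_rec md sd) PoszD.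
by rewrite addrC addKr.
Qed.

Lemma uniq_simplex w : uniq w -> all (fun l => l < d.+1)%N w -> uniq (map v w).
Proof.
move=> uw /allP wd; rewrite map_inj_in_uniq // => l k lw kw.
by apply: v_inj; rewrite inE wd.
Qed.

Lemma simplex_rank m s : (s <= d)%N -> exists f,
  rho (cnt (simplex_boundary V)) m s <=
  (forms_rank (layer (simplex_boundary V) s) (iota 0 m) (iota 0 m) f)%:Z.
Proof.
move=> sd; exists (fun l => coord_form K (v l)); have [sm|ms] := ltnP s m.
  by rewrite rho_small.
have md : (m <= d)%N := leq_trans ms sd.
rewrite rho_simplex ?(leqW md) // lez_nat.
have uw : uniq (map v (iota 0 m)).
  apply: uniq_simplex; first exact: iota_uniq.
  by apply/allP => l; rewrite mem_iota add0n => /andP[_ lm]; apply: leq_trans lm _; apply: leqW.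
apply: leq_trans (forms_rank_coord _ uw uw); apply: subset_leq_card.
by apply/subsetP => F; rewrite !inE orbb.
Qed.

(** A face of size d misses exactly one vertex. If that is v_k, the face contains v_(k+1), ...,
    v_(d-k), so its monomial is divisible by the second product. *)
Lemma simplex_cyclic_rank k : (k.*2 < d)%N -> exists f,
  rho (cnt (simplex_boundary V)) k d <=
  (forms_rank (layer (simplex_boundary V) d) (iota 0 k.+1)
     (iota 0 k ++ iota k.+1 (d - k.*2)) f)%:Z.
Proof.
move=> kd; exists (fun l => coord_form K (v l)).
rewrite rho_simplex //; last by lia.
rewrite lez_nat.
have u1 : uniq (map v (iota 0 k.+1)).
  apply: uniq_simplex; first exact: iota_uniq.
  by apply/allP => l; rewrite mem_iota; lia.
have u2 : uniq (map v (iota 0 k ++ iota k.+1 (d - k.*2))).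
  apply: uniq_simplex.
    rewrite cat_uniq !iota_uniq andbT /=; apply/hasPn => l; rewrite !mem_iota; lia.
  by apply/allP => l; rewrite mem_cat !mem_iota; lia.
apply: leq_trans (forms_rank_coord _ u1 u2); apply: subset_leq_card.
apply/subsetP => F; rewrite in_simplex_layer // => /and3P[FV /eqP Fd Fall].
rewrite inE inE inE properEcard FV Fd Vd ltnSn eqxx all_iotaS Fall /=.
case kF: (v k \in F) => //=; rewrite map_cat all_cat Fall /=.
have kd' : (k < d.+1)%N by lia.
have FE : F = V :\ v k.
  apply/eqP; rewrite eqEcard Fd; apply/andP; split.
    apply/subsetP => x xF; rewrite !inE (subsetP FV) // andbT.
    by apply: contraFneq kF => <-.
  by have := cardsD1 (v k) V; rewrite vV // Vd add1n => -[<-].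
apply/allP => x /mapP[l]; rewrite mem_iota => lk ->; rewrite FE !inE vV; last by lia.
by rewrite andbT; apply/eqP => e; have : l = k; [apply: v_inj e; rewrite inE; lia|lia].
Qed.

End Simplex.

(** Each bound may use its own forms; genericity later lets one choice serve for all. The word
    [iota k.+1 (d - k.*2)] lists k+1, ..., d-k. *)
Theorem strongly_edge_decomposable_ranks C : strongly_edge_decomposable C -> forall d, has_dim C d ->
  (forall m s, (s <= d)%N -> exists f,
     rho (cnt C) m s <= (forms_rank (layer C s) (iota 0 m) (iota 0 m) f)%:Z) /\
  (forall k, (k.*2 < d)%N -> exists f,
     rho (cnt C) k d <=
     (forms_rank (layer C d) (iota 0 k.+1) (iota 0 k ++ iota k.+1 (d - k.*2)) f)%:Z).
Proof.
have iotaS m : iota 0 m.+1 = 0%N :: map S (iota 0 m).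
  by rewrite /= -[1%N]addn0 iotaDl.
have reg0 X s : exists f, rho (cnt X) 0 s <=
    (forms_rank (layer X s) (iota 0 0) (iota 0 0) f)%:Z.
  exists (fun _ _ => 0); rewrite rho0 /forms_rank.
  rewrite (@rank2_eq _ _ _ (restrict (layer X s)) _ (restrict (layer X s))) //.
  by rewrite rank2_restrict.
elim=> {C} [|V V0|C i j sC pC ltij eC lC sedc IHc sedl IHl] d dC.
- have d0 : d = 0%N.
    by case: dC => _ [F]; rewrite inE => /eqP->; rewrite cards0.
  split=> [m s|k]; rewrite d0 // leqn0 => /eqP->.
  case: m => [|m]; first exact: reg0.
  by exists (fun _ _ => 0); rewrite rhoS0.
- have Vd : #|V| = d.+1.
    have [x xV] := set0Pn _ V0; case: dC => le [F].
    rewrite inE => /proper_card FV Fd; apply/eqP; rewrite eqn_leq -{2}Fd FV andbT.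
    have := le (V :\ x); rewrite inE properD1 // => /(_ isT).
    by rewrite (cardsD1 x V) xV add1n ltnS.
  have [x0 _] := set0Pn _ V0.
  pose v l := nth x0 (enum V) l.
  have v_inj : {in [pred l | l < d.+1]%N &, injective v}.
    move=> l k; rewrite !inE => ld kd /eqP.
    by rewrite nth_uniq ?enum_uniq -?cardE ?Vd // => /eqP.
  have vV l : (l < d.+1)%N -> v l \in V.
    by move=> ld; rewrite -mem_enum mem_nth // -cardE Vd.
  split=> [m s|k]; first exact: (simplex_rank Vd v_inj vV).
  exact: (simplex_cyclic_rank Vd v_inj vV).
have ij : i != j by rewrite neq_ltn ltij.
(* By the nonzero Euler characteristic the contraction has the same [d], as the induction hypothesis
   requires. *)
have euC : euler C != 0 by apply: euler_neq0; apply: sed_contract ltij eC lC sedc sedl.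
have [IH1 IH2] := IHc d (contraction_dim sC pC ij euC dC).
have [e dE dl] := link_dim pC ij eC dC.
have [IL1 IL2] := IHl e dl.
pose Y s := layer (contraction C i j) s.
have Yi s F : F \in Y s -> i \notin F by case/layer_contraction.
have YX s F : F \in Y s -> F \in layer C s \/ (j \in F /\ i |: (F :\ j) \in layer C s).
  by move=> FY; case: (layer_contraction ij FY) => _; apply.
have Zij s G : G \in layer (link C [set i; j]) s ->
    [/\ i \notin G, j \notin G & i |: (j |: G) \in layer C s.+2] by apply: layer_link.
split=> [[|m] s sd|[|k] kd].
- exact: reg0.
- case: s sd => [|[|s]] sd.
  + by exists (fun _ _ => 0); rewrite rhoS0.
  + rewrite (rho_contraction_small _ sC ij lC) //.
    (* In degree 1 the link contributes nothing, so the set of its faces is taken empty. *)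
    have := @forms_rank_contraction i j (layer C 1) (Y 1%N) finset.set0 ij (@Yi 1%N) (@YX 1%N) _
      (iota 0 m.+1) (iota 0 m.+1) _ 0 (IH1 m.+1 1%N sd).
    case=> [G|| f le]; [by rewrite inE|by exists (fun _ _ => 0)|by exists f; rewrite addr0 in le].
  + rewrite (rho_contraction sC ij lC).
    apply: (forms_rank_contraction ij (@Yi s.+2) (@YX s.+2) (@Zij s) (IH1 _ _ sd)).
    rewrite iotaS; apply: (edge_rank_link ij (@Zij s)); apply: IL1.
    by rewrite dE !ltnS in sd.
(* The link has no faces of size d - 1, so the top face number of [C] is the sum of those of the
   contraction and of the link. *)
- have lk0 : cnt (link C [set i; j]) e.+1 = 0.
    apply/eqP; rewrite eqz_nat cards_eq0 -subset0; apply/subsetP => G.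
    by rewrite inE => /andP[/(proj1 dl) le /eqP Ge]; rewrite Ge ltnn in le.
  have -> : rho (cnt C) 0 d = rho (cnt (contraction C i j)) 0 d +
      rho (cnt (link C [set i; j])) 0 e.
    by rewrite !rho0 (cnt_contraction _ sC ij lC) dE /= lk0 add0r.
  rewrite dE; rewrite dE in IH1 IH2 kd.
  apply: (forms_rank_contraction ij (@Yi e.+2) (@YX e.+2) (@Zij e) (IH2 0%N kd)).
  (* For k = 0 the summand generated by y_0 alone already yields the whole top degree of the
     link. *)
  have [f le] := edge_rank_link ij (@Zij e) (reg0 (link C [set i; j]) e).
  exists f; apply: le_trans le _; rewrite lez_nat.
  by apply: rank2_le => u; exists u, 0; rewrite linear0 addr0.
- rewrite dE; rewrite dE in IH1 IH2 kd; rewrite (rho_contraction sC ij lC).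
  apply: (forms_rank_contraction ij (@Yi e.+2) (@YX e.+2) (@Zij e) (IH2 k.+1 kd)).
  (* The words for k + 1 are y_0 followed by the shifted words of the link for k. *)
  have -> : iota 0 k.+1 ++ iota k.+2 (e.+2 - k.+1.*2) =
      0%N :: map S (iota 0 k ++ iota k.+1 (e - k.*2)).
    by rewrite map_cat iotaS /= -[k.+2]add1n iotaDl doubleS !subSS.
  rewrite [iota 0 k.+2]iotaS; apply: (edge_rank_link ij (@Zij e)); apply: IL2.
  by rewrite doubleS !ltnS in kd.
Qed.

End RankBounds.

(** * Coordinate changes of the exterior algebra *)

Section ExtMap.
Variables (K : fieldType) (n : nat).
Local Notation E := {ffun {set 'I_n} -> K^o}.
Implicit Types (F G H : {set 'I_n}) (u v : E) (i j h : 'I_n) (phi psi : 'M[K]_n).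

Definition col_form phi i : 'I_n -> K := fun j => phi j i.

Lemma ext_mul_gen phi i (u : E) : ext_mul (ext_gen_image phi i) u = wedge (col_form phi i) u.
Proof.
apply/ffunP => H; rewrite ffunE wedgeE /col_form.
under eq_bigr => F _ do rewrite ffunE mulr_suml mulr_sumr.
rewrite exchange_big [RHS]big_mkcond /=; apply: eq_bigr => j _.
have [jH|jH] := boolP (j \in H); last first.
  rewrite big1 // => F FH; rewrite ffunE; case: eqP => [e|_]; last by rewrite mulr0 mul0r mulr0.
  by rewrite e sub1set (negbTE jH) in FH.
rewrite (bigD1 [set j]) ?sub1set //= ffunE eqxx mulr1 big1 ?addr0 => [|F /andP[_ Fj]]; last first.
  by rewrite ffunE (negbTE Fj) mulr0 mul0r mulr0.
rewrite mulrCA; congr (_ * (_ * _)); rewrite /ext_sign /pos_sign; congr (_ ^+ _).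
have pair_inj : injective (pair j : 'I_n -> 'I_n * 'I_n) by move=> x y [].
rewrite -(card_imset _ pair_inj); apply: eq_card => -[x y]; apply/idP/imsetP.
  by rewrite !inE /= => /and3P[/eqP-> /andP[yj yH] ltyj]; exists y; rewrite // !inE yH.
move=> [z]; rewrite !inE => /andP[zH ltzj] [-> ->] /=.
by rewrite eqxx zH ltzj neq_ltn ltzj.
Qed.

Lemma ext_monomial_imageE phi F :
  ext_monomial_image phi F = wedges (col_form phi) (enum F) (mono K finset.set0).
Proof.
rewrite /ext_monomial_image; elim: (enum F) => [|i s IH]; first by rewrite big_nil.
by rewrite big_cons IH ext_mul_gen.
Qed.

(** [ext_map] with values in [E], so that a linear structure can be declared on it. *)
Definition emap phi u : E := ext_map phi u.

Lemma emapE phi u : emap phi u = \sum_F u F *: (ext_monomial_image phi F : E).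
Proof. by apply/ffunP => G; rewrite ffunE sum_ffunE; apply: eq_bigr => F _; rewrite ffunE. Qed.

Lemma emap_is_linear phi : linear (emap phi).
Proof.
move=> c u v; rewrite !emapE scaler_sumr -big_split; apply: eq_bigr => F _ /=.
by rewrite !ffunE scalerDl scalerA.
Qed.

HB.instance Definition _ phi :=
  GRing.isLinear.Build K E E *:%R (emap phi) (emap_is_linear phi).

Lemma emap_mono phi F :
  emap phi (mono K F) = wedges (col_form phi) (enum F) (mono K finset.set0).
Proof.
rewrite emapE (bigD1 F) //= monoE eqxx scale1r ext_monomial_imageE big1 ?addr0 // => G GF.
by rewrite monoE (negbTE GF) scale0r.
Qed.

Lemma enum_setU1_min h F : (forall k, k \in F -> (h < k)%N) -> enum (h |: F) = h :: enum F.
Proof.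
move=> hF; have srt A : sorted (fun x y : 'I_n => (x < y)%N) (enum (A : {set 'I_n})).
  have -> : enum A = [seq x <- enum 'I_n | x \in A] by rewrite !enumT.
  apply: sorted_filter; first by move=> x y z; apply: ltn_trans.
  have -> : (fun x y : 'I_n => (x < y)%N) = relpre val ltn by [].
  by rewrite -sorted_map val_enum_ord iota_ltn_sorted.
apply: (@irr_sorted_eq _ (fun x y : 'I_n => (x < y)%N)) => //.
- by move=> x y z; apply: ltn_trans.
- by move=> x; rewrite ltnn.
- have /= := srt F; case E1: (enum F) => [//|k s] /= ->.
  by rewrite andbT; apply: hF; rewrite -mem_enum E1 mem_head.
- by move=> x; rewrite !inE !mem_enum !inE.
Qed.

(** Adjoining a smallest element extends [enum] at its head and creates no sign. *)
Lemma set_min_ind (P : {set 'I_n} -> Prop) :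
    P finset.set0 ->
    (forall h F, (forall k, k \in F -> (h < k)%N) -> P F -> P (h |: F)) ->
  forall F, P F.
Proof.
move=> P0 PS F; elim: {F}_.+1 {-2}F (ltnSn #|F|) => // m IH F Fm.
have [->//|/set0Pn[x xF]] := eqVneq F finset.set0.
have [h hF hmin] := arg_minnP (fun k : 'I_n => val k) xF.
have {}hF : h \in F := hF.
rewrite -(setD1K hF); apply: PS => [k|].
  by rewrite !inE => /andP[kh kF]; rewrite ltn_neqAle eq_sym kh hmin.
by apply: IH; rewrite (cardsD1 h F) hF in Fm.
Qed.

Lemma pos_sign_min h F : (forall k, k \in F -> (h < k)%N) -> pos_sign K h F = 1.
Proof.
move=> hF; rewrite /pos_sign (_ : [set _ in _ | _] = finset.set0) ?cards0 //.
by apply/setP => k; rewrite !inE; apply/andP => -[/hF]; lia.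
Qed.

Lemma emap_mono_min phi h F : (forall k, k \in F -> (h < k)%N) ->
  emap phi (mono K (h |: F)) = wedge (col_form phi h) (emap phi (mono K F)).
Proof. by move=> hF; rewrite !emap_mono enum_setU1_min. Qed.

Lemma wedge_emap_mono phi F i : wedge (col_form phi i) (emap phi (mono K F)) =
  if i \in F then 0 else pos_sign K i F *: emap phi (mono K (i |: F)).
Proof.
elim/set_min_ind: F i => [|h F hF IH] i.
  by rewrite inE pos_sign_min ?scale1r ?emap_mono_min // => k; rewrite inE.
have [ltih|lehi] := ltnP i h.
  have imin k : k \in h |: F -> (i < k)%N.
    by rewrite !inE => /orP[/eqP->//|/hF]; apply: ltn_trans.
  rewrite (emap_mono_min _ imin) pos_sign_min // scale1r.
  by case: ifP => // /imin; rewrite ltnn.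
rewrite !inE emap_mono_min //; have [->|ih] := eqVneq i h; first by rewrite wedge_sqr.
have {lehi ih} lthi : (h < i)%N by rewrite ltn_neqAle eq_sym ih.
rewrite wedge_anti IH /=; case: ifP => iF; first by rewrite linear0 oppr0.
rewrite linearZ /= -emap_mono_min; last first.
  by move=> k; rewrite !inE => /orP[/eqP->//|/hF].
rewrite setUCA pos_signU1 ?lthi ?mulN1r ?scaleNr //.
by apply/negP => /hF; rewrite ltnn.
Qed.

Definition form_image phi (a : 'I_n -> K) : 'I_n -> K := fun j => \sum_i phi j i * a i.

Lemma wedge_form_image phi a u :
  wedge (form_image phi a) u = \sum_i a i *: wedge (col_form phi i) u.
Proof.
rewrite /wedge; under [RHS]eq_bigr => i _ do rewrite scaler_sumr.
rewrite exchange_big; apply: eq_bigr => j _ /=; rewrite /form_image scaler_suml.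
by apply: eq_bigr => i _; rewrite scalerA mulrC.
Qed.

Lemma wedge1_mono i F :
  wedge1 i (mono K F) = if i \in F then 0 else pos_sign K i F *: mono K (i |: F).
Proof.
apply/ffunP => H; rewrite ffunE monoE.
case: (boolP (i \in F)) => iF; last rewrite [RHS]ffunE monoE.
  rewrite ffunE; case: ifP => // iH; case: eqP => [e|_]; last by rewrite mulr0.
  by rewrite -e setD11 in iF.
have [->|HF] := eqVneq H (i |: F).
  by rewrite setU11 setU1K // eqxx pos_signU1 // ltnn mul1r.
case: ifP => iH; last by rewrite scaler0.
case: eqP => [e|_]; last by rewrite mulr0 scaler0.
by rewrite -e setD1K ?eqxx in HF.
Qed.

Lemma emap_wedge phi a u : emap phi (wedge a u) = wedge (form_image phi a) (emap phi u).
Proof.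
rewrite wedge_form_image {1}/wedge linear_sum; apply: eq_bigr => i _; rewrite linearZ /=.
congr (_ *: _); rewrite [in LHS](mono_decomp u) [in RHS](mono_decomp u) !linear_sum /=.
apply: eq_bigr => F _; rewrite !linearZ /=; congr (_ *: _).
rewrite wedge_emap_mono wedge1_mono; case: ifP => _; first by rewrite linear0.
by rewrite linearZ.
Qed.

Lemma emap_wedges (T : Type) phi (f : T -> 'I_n -> K) w u :
  emap phi (wedges f w u) = wedges (fun l => form_image phi (f l)) w (emap phi u).
Proof. by elim: w => //= l w IH; rewrite emap_wedge IH. Qed.

Lemma emap_mono0 phi : emap phi (mono K finset.set0) = mono K finset.set0.
Proof. by rewrite emap_mono enum_set0. Qed.

Lemma emap_comp phi psi u : emap phi (emap psi u) = emap (phi *m psi) u.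
Proof.
rewrite (mono_decomp u) !linear_sum; apply: eq_bigr => F _; rewrite !linearZ /=.
congr (_ *: _); rewrite !emap_mono emap_wedges emap_mono0.
elim: (enum F) => //= i s ->; congr (wedge _ _); apply/funext => j.
by rewrite /form_image /col_form mxE.
Qed.

Lemma emap1 u : emap 1%:M u = u.
Proof.
rewrite (mono_decomp u) linear_sum; apply: eq_bigr => F _; rewrite linearZ /=.
congr (_ *: _); elim/set_min_ind: F => [|h F hF IH]; first exact: emap_mono0.
rewrite emap_mono_min // IH.
have -> : col_form 1%:M h = coord_form K h by apply/funext => j; rewrite /col_form mxE.
rewrite wedge_coord wedge1_mono pos_sign_min // scale1r.
by case: ifP => // /hF; rewrite ltnn.
Qed.

Lemma emapK phi u : phi \in unitmx -> emap phi (emap (invmx phi) u) = u.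
Proof. by move=> up; rewrite emap_comp mulmxV // emap1. Qed.

Lemma emapVK phi u : phi \in unitmx -> emap (invmx phi) (emap phi u) = u.
Proof. by move=> up; rewrite emap_comp mulVmx // emap1. Qed.

Lemma wedges_mono0_card (T : Type) (f : T -> 'I_n -> K) w G :
  wedges f w (mono K finset.set0) G != 0 -> #|G| = size w.
Proof.
elim: w G => [|l w IH] G /=.
  by rewrite monoE; case: (eqVneq G finset.set0) => [->|]; rewrite ?cards0 ?eqxx.
rewrite wedgeE => nz.
have [i iG nzi] : exists2 i, i \in G & wedges f w (mono K finset.set0) (G :\ i) != 0.
  apply: contrapT => no; case/negP: nz; apply/eqP/big1 => i iG.
  apply/eqP; rewrite !mulf_eq0; apply/orP; right; apply/orP; right.
  by apply/negPn/negP => nzi; apply: no; exists i.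
by rewrite (cardsD1 i) iG (IH _ nzi).
Qed.

Lemma restrict_emap phi s u :
  restrict (hdeg n s) (emap phi u) = emap phi (restrict (hdeg n s) u).
Proof.
apply/ffunP => G; rewrite ffunE !emapE !sum_ffunE inE.
case: ifP => Gs; last first.
  apply/esym/big1 => F _; rewrite !ffunE inE; case: ifP => Fs; last by rewrite scale0r.
  rewrite ext_monomial_imageE; set x := wedges _ _ _ G.
  have [->|] := eqVneq x 0; first by rewrite scaler0.
  by move/wedges_mono0_card; rewrite -cardE (eqP Fs) => e; rewrite e eqxx in Gs.
apply: eq_bigr => F _; rewrite !ffunE inE; case: ifP => // Fs.
rewrite ext_monomial_imageE; set x := wedges _ _ _ G.
have [->|] := eqVneq x 0; first by rewrite !scaler0.
by move/wedges_mono0_card; rewrite -cardE (eqP Gs) => e; rewrite -e eqxx in Fs.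
Qed.

End ExtMap.

(** * Face ideals as coordinate subspaces *)

Section FaceIdeal.
Variables (K : fieldType) (n : nat) (C : {set {set 'I_n}}).
Local Notation E := {ffun {set 'I_n} -> K^o}.
Hypothesis C_closed : subset_closed C.

(** [is_ideal] mentions no scalars; multiplying by constants supplies them. *)
Lemma ext_mul_const (c : K) (u : E) :
  ext_mul ([ffun G => c * (G == finset.set0)%:R] : {ffun {set 'I_n} -> K}) u = c *: u.
Proof.
apply/ffunP => H; rewrite !ffunE (bigD1 finset.set0) ?sub0set //= ffunE eqxx mulr1.
rewrite big1 ?addr0 => [|F /andP[_ F0]]; last first.
  by rewrite ffunE (negbTE F0) mulr0 mul0r mulr0.
rewrite finset.setD0 /ext_sign (_ : [set p | _] = finset.set0) ?cards0 ?mul1r //.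
by apply/setP => p; rewrite !inE.
Qed.

(** Elements vanishing on [C] form an ideal because [C] is closed under subsets, and they are
    spanned by the monomials of nonfaces. *)
Lemma face_idealP (u : E) : face_ideal C u <-> forall F, F \in C -> u F = 0.
Proof.
split=> [|uC].
  move=> /(_ (fun u => forall F, F \in C -> u F = 0)); apply.
  - split=> [F _|v w hv hw F FC|v w hw]; first by rewrite ffunE.
      by rewrite ffunE hv // hw // addr0.
    case: C_closed => _ sub.
    split=> F FC; rewrite ffunE big1 // => G GF.
      by rewrite hw ?mulr0 // (sub _ _ FC) // subsetDl.
    by rewrite hw ?mul0r ?mulr0 // (sub _ _ FC).
  - move=> _ [F FC ->] G GC; rewrite ffunE; case: eqP => // e.
    by rewrite -e GC in FC.
move=> I [I0 Ia Im] SI; rewrite (mono_decomp u).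
elim/big_ind: _ => //= F _; have [FC|FC] := boolP (F \in C).
  by rewrite uC // scale0r.
rewrite -ext_mul_const; apply: (Im _ _ _).1; apply: SI.
by exists F.
Qed.

End FaceIdeal.

(** * Generic initial ideals *)

Section Gin.
Variables (K : fieldType) (n : nat) (C : {set {set 'I_n}}).
Local Notation E := {ffun {set 'I_n} -> K^o}.
Hypothesis C_closed : subset_closed C.
Implicit Types (F G : {set 'I_n}) (phi : 'M[K]_n) (u : E).

Local Notation J := (face_ideal C : set {ffun {set 'I_n} -> K}).

Definition initial_set phi F : Prop :=
  exists u, (ext_map phi @` J)%classic u /\ is_initial u F.

Lemma image_face_idealP phi u :
  (ext_map phi @` J)%classic u <-> exists w, u = emap phi (restrict (~: C) w).
Proof.
split=> [[w Jw <-]|[w ->]].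
  exists w; congr ext_map; apply/ffunP => F; rewrite ffunE inE; case: ifP => // /negbFE FC.
  exact: (face_idealP C_closed w).1 Jw F FC.
exists (restrict (~: C) w) => //; apply/(face_idealP C_closed) => F FC.
by rewrite ffunE inE FC.
Qed.

(** The monomials that must not occur in an element with initial monomial e_F; the flag [b] adds F
    itself. *)
Definition above F (b : bool) : {set {set 'I_n}} :=
  [set G : {set 'I_n} | `[< ~ (G = F \/ revlex_lt G F) >] || b && (G == F)].

Definition initial_op phi F b : E -> E :=
  restrict (above F b) \o (emap phi \o restrict (~: C)).

Definition initial_rank phi F b : nat := rank2 (initial_op phi F b) (initial_op phi F b).

(** e_F is initial exactly when forgetting the coordinate F loses rank, that is, when some element
    of the transformed ideal is nonzero at F and zero at all monomials above. Initial monomials are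
    thus determined by finitely many ranks. *)
Lemma initial_setP phi F :
  initial_set phi F <-> (initial_rank phi F true != initial_rank phi F false).
Proof.
have aboveF v : restrict (above F false) (restrict (above F true) v) =
    restrict (above F false) v.
  by apply/ffunP => G; rewrite !ffunE !inE /=; case: `[< _ >].
pose g := restrict (above F true) \o (emap phi \o restrict (~: C)).
have rkE : initial_rank phi F false =
    rank2 (restrict (above F false) \o g) (restrict (above F false) \o g).
  apply: (@rank2_eq _ _ (restrict (above F false) \o (emap phi \o restrict (~: C))) _
    (restrict (above F false) \o (emap phi \o restrict (~: C)))) => w /=; exact/esym/aboveF.
split=> [[u [/image_face_idealP[w uw] [uF ulow]]]|].
  apply: contraNneq uF => /eqP rk.
  (* With zero maps as source, equal ranks make the projection to [above F false] injective on the
     image, so u would vanish at F. *)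
  have [||||||v1 [v2]] := @rank2_exact _ _ (restrict (above F false)) (restrict finset.set0)
    (restrict finset.set0) g g _ _ _ _ _ w _.
  - by move=> v; exists 0, 0; apply/ffunP => G; rewrite !linear0 addr0 !ffunE inE.
  - by move=> v; exists 0, 0; apply/ffunP => G; rewrite !linear0 addr0 !ffunE inE.
  - by move=> v; apply/ffunP => G; rewrite !ffunE !inE; case: ifP.
  - by move=> v; apply/ffunP => G; rewrite !ffunE !inE; case: ifP.
  - by rewrite -rkE rank2_restrict cards0 add0n -(eqP rk).
  - rewrite /= aboveF -uw; apply/ffunP => G; rewrite ffunE inE orbF [RHS]ffunE.
    case: ifP => // /asboolP no; apply/eqP/negPn/negP => /ulow.
    exact: no.
  move=> /= /(congr1 (fun v : E => v F)); rewrite -uw ffunE inE eqxx orbT => ->.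
  by rewrite !ffunE !inE addr0.
move=> rk; apply: contrapT => no; case/eqP: rk; rewrite rkE.
apply/eqP; rewrite eqn_leq rank2_comp andbT; apply: rank2_inj => w; rewrite /= aboveF => z.
apply/ffunP => G; rewrite ffunE [RHS]ffunE inE.
have low H : ~ (H = F \/ revlex_lt H F) -> emap phi (restrict (~: C) w) H = 0.
  move=> nH; have := congr1 (fun v : E => v H) z; rewrite ffunE inE [RHS]ffunE.
  by case: asboolP.
case: asboolP => /= [nG|_]; first exact: low.
case: eqP => // ->; apply/eqP/negPn/negP => nz; apply: no.
exists (emap phi (restrict (~: C) w)); split; first by apply/image_face_idealP; exists w.
split=> // H nzH; apply: contrapT => /low e; by rewrite e eqxx in nzH.
Qed.

Lemma initial_ideal_eq phi psi :
    (forall F b, initial_rank phi F b = initial_rank psi F b) ->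
  initial_ideal (ext_map phi @` J)%classic = initial_ideal (ext_map psi @` J)%classic.
Proof.
move=> rk; congr ideal_gen; apply/seteqP.
have eqI F : initial_set phi F <-> initial_set psi F by rewrite !initial_setP !rk.
split=> w [u [F [Ju iF ->]]].
  by have [v [Jv iv]] := (eqI F).1 (ex_intro _ u (conj Ju iF)); exists v, F.
by have [v [Jv iv]] := (eqI F).2 (ex_intro _ u (conj Ju iF)); exists v, F.
Qed.

Definition mpoly_fun (q : 'M[K]_n -> K) : Prop :=
  exists p : mpoly.mpoly (n * n) K,
    forall phi, q phi = mpoly.meval (fun k => mxvec phi 0 k) p.

Lemma mpoly_fun_ring : function_ring mpoly_fun.
Proof.
split=> [c|q q' [p e] [p' e']|q q' [p e] [p' e']].
- by exists (mpoly.mpolyC _ c) => phi; rewrite mpoly.mevalC.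
- by exists (p + p') => phi; rewrite mpoly.mevalD e e'.
- by exists (p * p') => phi; rewrite mpoly.mevalM e e'.
Qed.

Lemma mpoly_fun_entry i j : mpoly_fun (fun phi => phi i j).
Proof.
exists (mpoly.mpolyX _ (mpoly.mnm1 (mxvec_index i j))) => phi.
by rewrite mpoly.mevalXU mxvecE.
Qed.

Lemma mpoly_fun_initial_op F b u G : mpoly_fun (fun phi => initial_op phi F b u G).
Proof.
have := @linear_fun_ring _ _ _ _ mpoly_fun_ring (restrict (above F b))
  (fun phi => emap phi (restrict (~: C) u)) G; apply => H.
have -> : (fun phi => emap phi (restrict (~: C) u) H) =
    fun phi => \sum_D restrict (~: C) u D * wedges (col_form phi) (enum D) (mono K finset.set0) H.
  by apply/funext => phi; rewrite ffunE; apply: eq_bigr => D _; rewrite ext_monomial_imageE.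
apply: (function_ring_sum mpoly_fun_ring) => D.
case: mpoly_fun_ring => Rc _ Rm; apply: (Rm _ _ (Rc _)).
apply: (wedges_fun_ring mpoly_fun_ring) => l i; exact: mpoly_fun_entry.
Qed.

(** Take [phi0] maximising the sum of all these ranks. Near [phi0] no rank drops, so by maximality
    none changes, and the initial ideal is constant there. *)
Lemma gin_exists : is_gin J (gin J).
Proof.
apply: xgetPex.
pose tot phi : nat := (\sum_F \sum_b initial_rank phi F b)%N.
have ub phi : (tot phi <= \sum_(F : {set 'I_n}) \sum_(b : bool) #|{set 'I_n}|)%N.
  by do 2!(apply: leq_sum => ? _); apply: rank_leq_col.
pose P k := `[< exists phi : 'M[K]_n, phi \in unitmx /\ tot phi = k >].
have exP : exists k, P k by exists (tot 1%:M); apply/asboolP; exists 1%:M; rewrite unitmx1.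
have ubP k : P k -> (k <= \sum_(F : {set 'I_n}) \sum_(b : bool) #|{set 'I_n}|)%N.
  by move=> /asboolP[phi [_ <-]].
case: (ex_maxnP exP ubP) => _ /asboolP[phi0 [u0 <-]] maxP.
have [q hq] := choice (fun Fb : {set 'I_n} * bool =>
  rank2_lower_semicontinuous mpoly_fun_ring
    (g1 := fun phi => initial_op phi Fb.1 Fb.2) (g2 := fun phi => initial_op phi Fb.1 Fb.2)
    (mpoly_fun_initial_op Fb.1 Fb.2) (mpoly_fun_initial_op Fb.1 Fb.2) phi0).
(* [p] multiplies the certificates of all ranks at [phi0]; its nonvanishing defines the open set. *)
have [|p pE] := @function_ring_prod _ _ _ mpoly_fun_ring _ (index_enum _) xpredT q.
  by move=> Fb; case: (hq Fb).
exists (initial_ideal (ext_map phi0 @` J)%classic).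
exists [set phi | phi \in unitmx /\ exists2 p', [set p]%classic p' &
  mpoly.meval (fun k => mxvec phi 0 k) p' != 0]%classic; split.
- by exists [set p]%classic.
- exists phi0; split=> //; exists p => //; rewrite -pE.
  by apply/prodf_neq0 => Fb _; case: (hq Fb).
move=> phi [uphi [_ -> ]]; rewrite -pE => /prodf_neq0 nz.
have ge F b : (initial_rank phi0 F b <= initial_rank phi F b)%N.
  by have [_ _ /(_ phi)] := hq (F, b); apply; apply: nz.
have totle : (tot phi <= tot phi0)%N by apply: maxP; apply/asboolP; exists phi.
apply: initial_ideal_eq => F b; apply/eqP.
have rE k : \sum_F \sum_b initial_rank k F b = \sum_(Fb : {set 'I_n} * bool) initial_rank k Fb.1 Fb.2.
  by rewrite pair_big.
have := leqif_sum (fun (Fb : {set 'I_n} * bool) (_ : true) => leqif_eq (ge Fb.1 Fb.2)).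
rewrite -!rE => -[_ /esym]; rewrite eqn_leq totle andbT.
have -> : (\sum_F \sum_b initial_rank phi0 F b <= \sum_F \sum_b initial_rank phi F b)%N.
  by do 2!(apply: leq_sum => ? _).
by move=> /forall_inP/(_ (F, b) isT); rewrite eq_sym.
Qed.

End Gin.

(** * A common generic point for coordinate changes and linear forms *)

Section GinPoint.
Variables (K : fieldType) (n : nat) (C : {set {set 'I_n}}).
Hypothesis K_infinite : infinite_set [set: K]%classic.
Hypothesis C_closed : subset_closed C.
Local Notation E := {ffun {set 'I_n} -> K^o}.
Implicit Types (phi : 'M[K]_n) (f : nat -> 'I_n -> K).

Definition matrix_curve (g : K -> 'M[K]_n) : Prop :=
  forall i j, exists p : {poly K}, forall t, g t i j = p.[t].

Lemma matrix_curve_join phi psi :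
  exists g, [/\ matrix_curve g, g 0 = phi & g 1 = psi].
Proof.
exists (fun t => phi + t *: (psi - phi)); split.
- move=> i j; exists ((phi i j)%:P + 'X * (psi i j - phi i j)%:P) => t.
  by rewrite !hornerE !mxE.
- by rewrite scale0r addr0.
- by rewrite scale1r addrC subrK.
Qed.

Lemma matrix_curve_det m (A : 'M[K]_n -> 'M[K]_m) :
    (forall i j, curve_poly matrix_curve (fun phi => A phi i j)) ->
  curve_poly matrix_curve (fun phi => \det (A phi)).
Proof. exact: function_ring_det (curve_poly_ring _) _ _. Qed.

Lemma matrix_curve_adj i j : curve_poly matrix_curve (fun phi => (\adj phi) i j).
Proof.
have -> : (fun phi => (\adj phi) i j) =
    fun phi => (-1) ^+ (j + i) * \det (row' j (col' i phi)).
  by apply/funext => phi; rewrite mxE.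
have [Rc _ Rm] := curve_poly_ring matrix_curve; apply: (Rm _ _ (Rc _)).
apply: matrix_curve_det => k l g cg.
by have [p e] := cg (lift j k) (lift i l); exists p => t; rewrite !mxE.
Qed.

Lemma matrix_curve_meval (p : mpoly.mpoly (n * n) K) :
  curve_poly matrix_curve (fun phi => mpoly.meval (fun k => mxvec phi 0 k) p).
Proof.
have ring := curve_poly_ring matrix_curve; have [Rc _ Rm] := ring.
have -> : (fun phi => mpoly.meval (fun k => mxvec phi 0 k) p) = fun phi =>
    \sum_(m <- mpoly.msupp p) mpoly.mcoeff m p * \prod_k mxvec phi 0 k ^+ mpoly.fun_of_multinom m k.
  by apply/funext => phi; rewrite mpoly.mevalE.
apply: (function_ring_sum ring) => m; apply: (Rm _ _ (Rc _)).
apply: (function_ring_prod ring) => k; apply: (function_ring_exp ring).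
case/mxvec_indexP: k => i j g cg; have [q e] := cg i j.
by exists q => t; rewrite mxvecE.
Qed.

(* The form e_(n - l) in the labelling by 1, ..., n; it is zero for l >= n. *)
Definition top_form (l : nat) : 'I_n -> K := fun i => (i.+1 + l == n)%:R.

(** The forms are read off from the inverse of [phi]. Its adjugate is used instead because its
    entries are polynomial in [phi]; the scale invariance of [P] absorbs the determinant. *)
Lemma gin_point (P : (nat -> 'I_n -> K) -> Prop) :
    curve_open (@form_curve K n) P -> (exists f, P f) ->
    (forall f (c : nat -> K), (forall l, c l != 0) -> P f -> P (fun l i => c l * f l i)) ->
  exists phi f, [/\ phi \in unitmx,
    initial_ideal (ext_map phi @` face_ideal C)%classic = gin (face_ideal C), P f &
    forall l, (l < n)%N -> form_image phi (f l) = top_form l].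
Proof.
move=> oP exP scaleP.
(* The columns are f(n-1), ..., f(0), so the inverse of [B f] sends f(l) to e_(n-l). *)
pose B f : 'M[K]_n := \matrix_(k, x) f (n - x.+1)%N k.
have oB : curve_open (@form_curve K n) (fun f => \det (B f) != 0).
  move=> f0 h0; exists (fun f => \det (B f)); split=> // g cg.
  have := function_ring_det (curve_poly_ring (@form_curve K n)) (A := B); apply=> // i j h ch.
  by have [p e] := ch (n - j.+1)%N i; exists p => t; rewrite mxE.
have exB : exists f, \det (B f) != 0.
  exists top_form; rewrite (_ : B _ = 1%:M) ?det1 ?oner_eq0 //.
  apply/matrixP => i j; rewrite !mxE /top_form; congr (_%:R); congr nat_of_bool.
  rewrite -(inj_eq val_inj) /=; have := ltn_ord i; have := ltn_ord j; lia.
have [f0 [Pf0 Bf0]] := curve_open_meet K_infinite (@form_curve_join K n) oP oB exP exB.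
(* For l < n these are the columns of the adjugate in reverse order; for l >= n the forms of [f0]
   are kept. *)
pose forms_of phi l i := if insub l is Some x then (\adj phi) i (rev_ord x) else f0 l i.
have oQ : curve_open matrix_curve (fun phi => P (forms_of phi)).
  move=> phi0 /oP[q [cq q0 hq]]; exists (fun phi => q (forms_of phi)); split=> //.
    move=> g cg; have := cq (fun t => forms_of (g t)); apply=> l i.
    rewrite /forms_of; case: insubP => [x _ _|_]; first exact: matrix_curve_adj.
    by exists (f0 l i)%:P => t; rewrite hornerC.
  by move=> phi; apply: hq.
have uB : B f0 \in unitmx by rewrite unitmxE unitfE.
have adjE phi : phi \in unitmx -> \adj phi = \det phi *: invmx phi.
  move=> u; rewrite /invmx u scalerA divff ?scale1r //.
  by rewrite -unitfE -unitmxE.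
have exQ : exists phi, P (forms_of phi).
  (* Here the forms are [f0] up to nonzero factors, so [P] holds. *)
  exists (invmx (B f0)); set phi1 := invmx (B f0).
  have u1 : phi1 \in unitmx by rewrite unitmx_inv.
  have -> : forms_of phi1 =
      fun l i => (if (l < n)%N then \det phi1 else 1) * f0 l i.
    apply/funext => l; apply/funext => i; rewrite /forms_of.
    case: insubP => [x -> xl|/negbTE->]; last by rewrite mul1r.
    rewrite adjE // invmxK mxE mxE /= -xl; congr (_ * f0 _ _).
    by have := ltn_ord x; rewrite /=; lia.
  apply: scaleP => // l; case: ifP => _; last exact: oner_neq0.
  by rewrite -unitfE -unitmxE.
have [U [[S US] [phi2 Uphi2] hU]] := gin_exists K C_closed.
move: Uphi2; rewrite US => -[u2 [p Sp p2]].
have oO : curve_open matrix_curve (fun phi => phi \in unitmx /\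
    mpoly.meval (fun k => mxvec phi 0 k) p != 0).
  apply: curve_open_and => phi0 h0.
    exists (fun phi => \det phi); split.
    - by apply: matrix_curve_det => i j g cg.
    - by rewrite -unitfE -unitmxE.
    - by move=> phi; rewrite unitmxE unitfE.
  by exists (fun phi => mpoly.meval (fun k => mxvec phi 0 k) p); split=> //; exact: matrix_curve_meval.
have exO : exists phi, phi \in unitmx /\ mpoly.meval (fun k => mxvec phi 0 k) p != 0.
  by exists phi2.
have [phi [Qphi [uphi pphi]]] := curve_open_meet K_infinite matrix_curve_join oQ oO exQ exO.
have dphi : \det phi != 0 by rewrite -unitfE -unitmxE.
exists phi, (fun l i => (if (l < n)%N then (\det phi)^-1 else 1) * forms_of phi l i); split=> //.
- by apply: hU; rewrite US; split=> //; exists p.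
- by apply: scaleP => // l; case: ifP => _; rewrite ?invr_eq0 ?oner_neq0.
move=> l ln; apply/funext => j; rewrite /form_image /top_form ln /forms_of insubT /=.
transitivity ((phi *m invmx phi) j (rev_ord (Ordinal ln))).
  rewrite mxE; apply: eq_bigr => i _; rewrite adjE // mxE; congr (_ * _).
  by rewrite mulrA mulVf // mul1r.
rewrite mulmxV // mxE -(inj_eq val_inj) /=; congr (_%:R); congr nat_of_bool.
by have := ltn_ord j; lia.
Qed.

End GinPoint.

(** * Exactness and standard sets *)

Local Arguments wedges : simpl never.
Local Arguments iota : simpl never.

Section Exactness.
Variables (K : fieldType) (n : nat) (C : {set {set 'I_n}}).
Hypothesis C_closed : subset_closed C.
Local Notation E := {ffun {set 'I_n} -> K^o}.
Variable f : nat -> 'I_n -> K.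

Local Notation W m := (wedges f (iota 0 m)).

Lemma wedges_iotaS m (u : E) : W m.+1 u = W m (wedge (f m) u).
Proof. by rewrite -addn1 iotaD wedges_cat. Qed.

Definition regular_rank m s : nat := forms_rank (layer C s) (iota 0 m) (iota 0 m) f.

Lemma restrict_layer_wedge s a (u : E) :
  restrict (layer C s.+1) (wedge a (restrict (layer C s) u)) = restrict (layer C s.+1) (wedge a u).
Proof.
apply: restrict_wedge => F i; rewrite !inE => /andP[FC Fs] iF.
rewrite (cardsD1 i) iF add1n eqSS in Fs; rewrite Fs andbT.
by case: C_closed => _ sub; apply: sub FC _; apply: subD1set.
Qed.

Section Step.
Variables m s : nat.

Let g : {linear E -> E} := restrict (layer C s) \o W m.
Let h : {linear E -> E} := restrict (layer C s) \o W m.+1.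
Let b : {linear E -> E} := restrict (layer C s.+1) \o wedge (f m).

Lemma regular_image u : exists v1 v2, h u = g v1 + g v2.
Proof. by exists (wedge (f m) u), 0; rewrite linear0 addr0 /h /g /= wedges_iotaS. Qed.

Lemma regular_complex u : b (h u) = 0.
Proof.
by rewrite /b /h /= restrict_layer_wedge wedges_iotaS wedge_wedges wedge_sqr !linear0.
Qed.

Lemma regular_next : (regular_rank m.+1 s.+1 <= rank2 (b \o g) (b \o g))%N.
Proof.
apply: rank2_le => u; exists ((-1) ^+ m *: u), 0; rewrite linear0 addr0 /b /g /=;
by rewrite restrict_layer_wedge wedge_wedges size_iota !linearZ /= scalerA -expr2 sqrr_sign
  scale1r wedges_iotaS.
Qed.

(** On y_0 ... y_(m-1) K{C}, the image of multiplication by y_m is y_0 ... y_m K{C} one degree up,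
    and its kernel contains y_0 ... y_m K{C} because y_m squares to zero. *)
Lemma regular_rank_step : (regular_rank m.+1 s + regular_rank m.+1 s.+1 <= regular_rank m s)%N.
Proof.
apply: leq_trans (leq_add (leqnn _) regular_next) _.
by apply: rank2_ker; [exact: regular_image|exact: regular_image|exact: regular_complex|exact: regular_complex].
Qed.

Lemma regular_exact x :
    (regular_rank m s <= regular_rank m.+1 s + regular_rank m.+1 s.+1)%N ->
    restrict (layer C s.+1) (wedge (f m) (W m x)) = 0 ->
  exists y, restrict (layer C s) (W m x) = restrict (layer C s) (W m.+1 y).
Proof.
move=> le bx.
have le' : (rank2 g g <= rank2 h h + rank2 (b \o g) (b \o g))%N.
  by apply: leq_trans le _; rewrite leq_add2l; exact: regular_next.
have [|v1 [v2 e]] := rank2_exact regular_image regular_image regular_complex regular_complex le' (u := x).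
  by rewrite /b /g /= restrict_layer_wedge.
by exists (v1 + v2); rewrite linearD linearD.
Qed.

End Step.

(** By induction r_(m+1)(s+1) <= r_m(s) - r_(m+1)(s) <= rho_m(s) - rho_(m+1)(s), which is
    rho_(m+1)(s+1). *)
Lemma regular_rank_upper d :
    (forall m s, (m <= n)%N -> (s <= d)%N -> rho (cnt C) m s <= (regular_rank m s)%:Z) ->
  forall m s, (m <= n)%N -> (s <= d)%N -> (regular_rank m s)%:Z <= rho (cnt C) m s.
Proof.
move=> lower; elim=> [|m IH] s mn.
  move=> _; rewrite rho0 /regular_rank /forms_rank.
  rewrite (@rank2_eq _ _ _ (restrict (layer C s)) _ (restrict (layer C s))) //.
  by rewrite rank2_restrict.
elim: s => [|s IHs] sd.
  rewrite rhoS0 lez_nat /regular_rank /forms_rank.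
  apply: (@leq_trans #|finset.set0 : {set {set 'I_n}}|); last by rewrite cards0.
  rewrite -(rank2_restrict K).
  (* A product of at least one form has no component in degree 0. *)
  have z (u : E) F : F \in layer C 0 -> W m.+1 u F = 0.
    rewrite inE cards_eq0 => /andP[_ /eqP->].
    by rewrite [LHS]wedgeE big_pred0 // => i; rewrite inE.
  by apply: rank2_le => u; exists 0, 0; rewrite !linear0 addr0 /=; apply/ffunP => F;
    rewrite ffunE [RHS]ffunE; case: ifP => // /z ->.
rewrite rhoSS; have := regular_rank_step m s.
have := IH s (ltnW mn) (ltnW sd); have := lower m.+1 s mn (ltnW sd); lia.
Qed.

End Exactness.

(** * Reverse lexicographic comparisons from the top vertex down *)

Section Order.
Variables (n : nat) (x0 : 'I_n).
Implicit Types (F G : {set 'I_n}).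

(** The vertex labelled n - l, as in [top_form]; [x0] enters only as a default for l >= n. *)
Definition top_vertex (l : nat) : 'I_n := rev_ord (insubd x0 l).

Lemma top_vertexE l : (l < n)%N -> top_vertex l = (n - l.+1)%N :> nat.
Proof. by move=> ln; rewrite /= insubdK. Qed.

Lemma top_vertexK (i : 'I_n) : top_vertex (n - i.+1) = i.
Proof. by apply: ord_inj; rewrite top_vertexE; have := ltn_ord i; lia. Qed.

Lemma top_form_coord (K : fieldType) l : (l < n)%N ->
  @top_form K n l = coord_form K (top_vertex l).
Proof.
move=> ln; apply/funext => i; rewrite /top_form /coord_form -(inj_eq val_inj) /=.
rewrite insubdK //; congr (_%:R); congr nat_of_bool; have := ltn_ord i; lia.
Qed.

Lemma top_vertex_uniq w : all (fun l => l < n)%N w -> uniq w -> uniq (map top_vertex w).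
Proof.
move=> /allP wn uw; rewrite map_inj_in_uniq // => k l /wn kn /wn ln /(congr1 val).
by rewrite /= !insubdK //; lia.
Qed.

(** The largest vertex where G and F differ is missing from F, so it lies below the m top
    vertices. *)
Lemma revlex_lt_top m F G : (m <= n)%N -> (forall l, (l < m)%N -> top_vertex l \in F) ->
    revlex_lt G F -> #|G| = #|F| -> forall l, (l < m)%N -> top_vertex l \in G.
Proof.
move=> mn Fm ltGF GF l lm; case: ltGF => [|[_ [i [iG iF eqi]]]]; first by rewrite GF ltnn.
have ln := leq_trans lm mn.
have [li|il] := leqP (n - i.+1) l; last first.
  by rewrite eqi ?Fm // top_vertexE //; lia.
by rewrite -(top_vertexK i) Fm ?(leq_ltn_trans li) in iF.
Qed.

Lemma revlex_lt_setU1 x F G : x \notin F -> x \notin G ->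
  revlex_lt (x |: G) (x |: F) -> revlex_lt G F.
Proof.
move=> xF xG; rewrite /revlex_lt !cardsU1_notin // ltnS => -[lt|[[e] [i [iG iF eqi]]]]; first by left.
right; split=> //; exists i; move: iF; rewrite !inE negb_or => /andP[ix iF].
move: iG; rewrite !inE (negbTE ix) /= => iG; split=> // j ij.
have := eqi j ij; rewrite !inE; case: (eqVneq j x) => [->|//] _.
by rewrite (negbTE xF) (negbTE xG).
Qed.

Lemma revlex_lt_first_missing m F G : (m < n)%N -> #|G| = #|F| ->
    (forall l, (l < m)%N -> (top_vertex l \in G) = (top_vertex l \in F)) ->
    top_vertex m \notin F -> top_vertex m \in G ->
  revlex_lt G F.
Proof.
move=> mn GF eqm mF mG; right; split=> //; exists (top_vertex m); split=> // j.
rewrite top_vertexE // -{2 3}(top_vertexK j) => mj; apply: eqm.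
by have := ltn_ord j; lia.
Qed.

End Order.

(** * Extending standard sets and recognising cyclic facets *)

Section Main.
Variables (K : fieldType) (n d : nat) (C : {set {set 'I_n}}).
Hypothesis C_closed : subset_closed C.
Hypothesis C_dim : has_dim C d.
Local Notation E := {ffun {set 'I_n} -> K^o}.
Implicit Types F G : {set 'I_n}.
Variables (phi : 'M[K]_n) (f : nat -> 'I_n -> K) (x0 : 'I_n).
Hypothesis phi_unit : phi \in unitmx.
Hypothesis phi_forms : forall l, (l < n)%N -> form_image phi (f l) = @top_form K n l.
Hypothesis reg_lower : forall m s, (m <= n)%N -> (s <= d)%N ->
  rho (cnt C) m s <= (regular_rank C f m s)%:Z.
Hypothesis cyc_lower : forall k, (k.*2 < d)%N ->
  rho (cnt C) k d <=
  (forms_rank (layer C d) (iota 0 k.+1) (iota 0 k ++ iota k.+1 (d - k.*2)) f)%:Z.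
Local Notation v := (top_vertex x0).

Lemma emap_forms w (u : E) : all (fun l => l < n)%N w ->
  emap phi (wedges f w u) = wedges (@top_form K n) w (emap phi u).
Proof.
move=> /allP wn; rewrite emap_wedges; apply: eq_wedges => l /wn ln x.
by rewrite phi_forms.
Qed.

Lemma wedge_top w : all (fun l => l < n)%N w ->
  forall l, List.In l w -> wedge (@top_form K n l) =1 wedge1 (v l).
Proof.
move=> wn l lw u; rewrite (top_form_coord x0) ?wedge_coord //.
by elim: w wn lw => //= k w IH /andP[kn wn] [<-|/(IH wn)].
Qed.

(** [phi] preserves degrees, and the degree-s component of x lies in the face ideal once x vanishes
    on the faces of size s. *)
Lemma initial_of_layer s F (x : E) :
    restrict (layer C s) x = 0 ->
    is_initial (restrict (hdeg n s) (emap phi x)) F ->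
  initial_set C phi F.
Proof.
move=> xz iF; exists (restrict (hdeg n s) (emap phi x)); split=> //.
exists (restrict (hdeg n s) x); last by rewrite restrict_emap.
apply/(face_idealP C_closed) => G GC; rewrite ffunE inE; case: ifP => // Gs.
by have := congr1 (fun w : E => w G) xz; rewrite /= !ffunE inE GC Gs.
Qed.

(** An element with initial monomial [v m |: F] has, in degree s + 1, the form e_(v_m) /\ z with z a
    multiple of the m top coordinate vectors. Exactness then corrects z by a multiple t of the m + 1
    top vectors so that z - t comes from the face ideal; t only involves monomials below F. *)
Lemma initial_down m F : (m < n)%N -> (forall l, (l < m)%N -> v l \in F) ->
    v m \notin F -> (#|F| < d)%N ->
  initial_set C phi (v m |: F) -> initial_set C phi F.
Proof.
move=> mn Fm mF; set s := #|F| => sd [u' [[w Jw <-] [uF ulow]]].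
have {}Jw := (face_idealP C_closed w).1 Jw.
pose ud := restrict (hdeg n s.+1) (emap phi w).
have udsupp G : ud G != 0 -> [/\ #|G| = s.+1, G = v m |: F \/ revlex_lt G (v m |: F) &
    forall l, (l < m.+1)%N -> v l \in G].
  rewrite ffunE inE; case: (#|G| =P s.+1) => [Gs nz|_]; last by rewrite eqxx.
  have Fm' l : (l < m.+1)%N -> v l \in v m |: F.
    by rewrite ltnS leq_eqVlt !inE => /orP[/eqP->|/Fm->]; rewrite ?eqxx ?orbT.
  split=> //; first exact: ulow.
  case: (ulow _ nz) => [->//|lt]; apply: (revlex_lt_top mn Fm' lt).
  by rewrite Gs cardsU1_notin.
(* All monomials of [ud] contain v_0, ..., v_m, so nothing is lost by dividing by e_(v_m). *)
pose z := interior (v m) ud.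
have zsupp G : z G != 0 -> v m \notin G /\ ud (v m |: G) != 0.
  rewrite ffunE; case: ifP => mG; first by rewrite eqxx.
  by rewrite mulf_eq0 negb_or => /andP[].
have iota_n k : (k <= n)%N -> all (fun l => l < n)%N (iota 0 k).
  by move=> kn; apply/allP => l; rewrite mem_iota; lia.
have [|||x' zE] := @wedges_coord_supp K n _ (@top_form K n) v (iota 0 m) z.
- by apply: wedge_top; apply: iota_n; apply: ltnW.
- by apply: top_vertex_uniq; [apply: iota_n; apply: ltnW|exact: iota_uniq].
- move=> G /zsupp[mG /udsupp[_ _ Gm]] y /mapP[l]; rewrite mem_iota add0n => /andP[_ lm] ->.
  have := Gm l (leqW lm); rewrite !inE => /orP[/eqP/(congr1 val)|//].
  by rewrite /= !insubdK //; rewrite ?inE; lia.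
have udE : wedge1 (v m) z = ud.
  apply/ffunP => G; rewrite wedge1_interior; case: ifP => // mG.
  by apply/esym/eqP; apply: contraFT mG => /udsupp[_ _]; apply.
pose x := emap (invmx phi) x'.
(* Before the coordinate change, the multiple of x by y_m y_0 ... y_(m-1) is the degree s + 1 part
   of w, which is zero in K{C}. *)
have xE : wedge (f m) (wedges f (iota 0 m) x) = restrict (hdeg n s.+1) w.
  rewrite -[LHS](emapVK _ phi_unit) -[RHS](emapVK _ phi_unit); congr emap.
  rewrite emap_wedge phi_forms // emap_forms ?iota_n 1?ltnW // emapK // -zE.
  by rewrite (top_form_coord x0) // wedge_coord udE /ud restrict_emap.
have [||y yE] := @regular_exact K n C C_closed f m s x.
- have up := regular_rank_upper C_closed reg_lower.
  have := up m s (ltnW mn) (ltnW sd); have := reg_lower mn sd.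
  have := reg_lower mn (ltnW sd); rewrite rhoSS; lia.
- rewrite xE; apply/ffunP => G; rewrite !ffunE !inE.
  by case: ifP => // /andP[GC ->]; apply: Jw.
apply: (@initial_of_layer s _ (wedges f (iota 0 m) x - wedges f (iota 0 m.+1) y)).
  by rewrite linearB /= yE subrr.
have in1 := iota_n m (ltnW mn); have in2 := iota_n m.+1 mn.
rewrite linearB /= !emap_forms // emapK // -zE.
set t := wedges _ _ (emap phi y).
have tsupp G : t G != 0 -> forall l, (l < m.+1)%N -> v l \in G.
  move=> tG l lm.
  have := @wedges_coord_sub K n _ _ v _ _ _ (wedge_top (iota_n _ mn)) tG (v l); apply.
  by rewrite map_f // mem_iota.
split.
  rewrite !ffunE inE eqxx (negbTE mF) inE cardsU1_notin // eqxx.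
  have -> : t F = 0 by apply/eqP; apply: contraNT mF => /tsupp; apply.
  by rewrite subr0 mulf_neq0 ?pos_sign_neq0 //; move: uF; rewrite ffunE.
move=> G; rewrite [restrict _ _ _]ffunE inE; case: (#|G| =P s) => Gs; last by rewrite eqxx.
have [tG|tG] := eqVneq (t G) 0; last first.
  (* Such G contains v_0, ..., v_m while F first fails at v_m. *)
  move=> _; right; apply: (@revlex_lt_first_missing _ x0 m) => //.
    by move=> l lm; rewrite Fm // (tsupp _ tG) // ltnW.
  exact: (tsupp _ tG).
have -> : (z - t) G = z G - t G by rewrite !ffunE.
rewrite tG subr0 => /zsupp[mG /udsupp[_ [e|lt] _]].
  by left; rewrite -(setU1K mG) e setU1K.
by right; apply: revlex_lt_setU1 lt.
Qed.

(** From c_k >= rho_k(d) = r_k(d), every multiple of y_0 ... y_(k-1) in degree d is a sum of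
    multiples using y_k or y_(k+1) ... y_(d-k). Applied to e_F, this gives t1 + t2 whose monomials
    of size d, apart from those cancelled, are smaller than F, as F misses both v_k and v_l. *)
Lemma initial_top k l F : #|F| = d -> (d < n)%N -> (k.*2 < d)%N ->
    (forall l', (l' < k)%N -> v l' \in F) -> v k \notin F ->
    (k < l)%N -> (l <= d - k)%N -> v l \notin F ->
  initial_set C phi F.
Proof.
move=> Fd dn kd Fk kF kl ld lF.
have ln : (l < n)%N by lia.
have kn : (k < n)%N := ltn_trans kl ln.
have all1 : all (fun l => l < n)%N (iota 0 k) by apply/allP => q; rewrite mem_iota; lia.
have all2 : all (fun l => l < n)%N (iota 0 k.+1) by apply/allP => q; rewrite mem_iota; lia.
have all3 : all (fun l => l < n)%N (iota 0 k ++ iota k.+1 (d - k.*2)).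
  by apply/allP => q; rewrite mem_cat !mem_iota; lia.
have [|||x' FE] := @wedges_coord_supp K n _ (@top_form K n) v (iota 0 k) (mono K F).
- exact: wedge_top.
- by apply: top_vertex_uniq; last exact: iota_uniq.
- move=> G; rewrite monoE; case: (eqVneq G F) => [-> _|]; last by rewrite eqxx.
  by move=> y /mapP[q]; rewrite mem_iota => /andP[_ qk] ->; apply: Fk.
pose x := emap (invmx phi) x'.
have [|||y1 [y2 yE]] := @rank2_full K n
    (restrict (layer C d) \o wedges f (iota 0 k.+1))
    (restrict (layer C d) \o wedges f (iota 0 k ++ iota k.+1 (d - k.*2)))
    (restrict (layer C d) \o wedges f (iota 0 k))
    (restrict (layer C d) \o wedges f (iota 0 k)) _ _ _ x.
- by move=> u; exists (wedge (f k) u), 0; rewrite linear0 addr0 /= wedges_iotaS.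
- by move=> u; exists (wedges f (iota k.+1 (d - k.*2)) u), 0; rewrite linear0 addr0 /= wedges_cat.
- have up := regular_rank_upper C_closed reg_lower (ltnW kn) (leqnn d).
  by have := le_trans up (cyc_lower kd); rewrite lez_nat.
apply: (@initial_of_layer d _ (wedges f (iota 0 k) x - wedges f (iota 0 k.+1) y1 -
    wedges f (iota 0 k ++ iota k.+1 (d - k.*2)) y2)).
  rewrite !linearB /=; move: yE => /= ->.
  by rewrite addrAC addrK subrr.
rewrite !linearB /= !emap_forms // emapK // -FE -!linearB /=.
set t1 := wedges _ _ (emap phi y1); set t2 := wedges _ _ (emap phi y2).
have t1supp G : t1 G != 0 -> forall q, (q <= k)%N -> v q \in G.
  move=> tG q qk.
  have := @wedges_coord_sub K n _ _ v _ _ _ (wedge_top all2) tG (v q); apply.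
  by rewrite map_f // mem_iota ltnS.
have t2supp G : t2 G != 0 -> forall q, (q < k)%N || (k < q <= d - k)%N -> v q \in G.
  move=> tG q qk.
  have := @wedges_coord_sub K n _ _ v _ _ _ (wedge_top all3) tG (v q); apply.
  by rewrite map_f // mem_cat !mem_iota; lia.
have diffE G : (mono K F - t1 - t2) G = mono K F G - t1 G - t2 G by rewrite !ffunE.
have ltl : (k < l <= d - k)%N by rewrite kl.
split.
  rewrite [restrict _ _ _]ffunE inE Fd eqxx diffE.
  have -> : t1 F = 0 by apply/eqP; apply: contraNT kF => /t1supp; apply.
  have -> : t2 F = 0 by apply/eqP; apply: contraNT lF => /t2supp; apply; rewrite ltl orbT.
  by rewrite monoE eqxx !subr0 oner_eq0.
move=> G; rewrite [restrict _ _ _]ffunE inE; case: (#|G| =P d) => Gd; last by rewrite eqxx.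
rewrite diffE monoE; have [->|GF] := eqVneq G F; first by left.
rewrite sub0r => nz; right.
have [kG|kG] := boolP (v k \in G).
  have [t1G|t1G] := eqVneq (t1 G) 0; last first.
    apply: (@revlex_lt_first_missing _ x0 k) => //; first by rewrite Gd.
    by move=> q qk; rewrite Fk // (t1supp _ t1G) // ltnW.
  have t2G : t2 G != 0 by apply: contraNneq nz => ->; rewrite t1G oppr0 addr0.
  apply: (@revlex_lt_first_missing _ x0 k) => //; first by rewrite Gd.
  by move=> q qk; rewrite Fk // (t2supp _ t2G) // qk.
have t1G : t1 G = 0 by apply/eqP; apply: contraNT kG => /t1supp; apply.
have t2G : t2 G != 0 by apply: contraNneq nz => ->; rewrite t1G oppr0 addr0.
have exl : exists q, (k < q)%N && (v q \notin F) by exists l; rewrite kl.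
(* When neither G nor F contains v_k, the comparison is decided at the next vertex v_q missing from
   F, which t2 forces into G. *)
case: (ex_minnP exl) => q /andP[kq qF] qmin.
have ql : (q <= l)%N by apply: qmin; rewrite kl.
apply: (@revlex_lt_first_missing _ x0 q) => //; [exact: leq_ltn_trans ql ln|by rewrite Gd| |].
  move=> r rq; have [rk|kr|->] := ltngtP r k; last by rewrite (negbTE kG) (negbTE kF).
    by rewrite Fk // (t2supp _ t2G) // rk.
  rewrite (t2supp _ t2G); last by rewrite kr (leq_trans (ltnW rq) (leq_trans ql ld)) orbT.
  by apply/esym/negPn/negP => rF; have := qmin r; rewrite kr rF leqNgt rq => /(_ isT).
by apply: (t2supp _ t2G); rewrite kq (leq_trans ql ld) orbT.
Qed.

Lemma initial_large F : (d < #|F|)%N -> initial_set C phi F.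
Proof.
move=> dF; apply: (@initial_of_layer #|F| _ (emap (invmx phi) (mono K F))).
  apply/ffunP => G; rewrite ffunE inE [RHS]ffunE; case: ifP => // /andP[GC /eqP GF].
  by have := C_dim.1 G GC; rewrite GF leqNgt dF.
rewrite emapK //; split; first by rewrite ffunE inE eqxx monoE eqxx oner_eq0.
move=> G; rewrite ffunE inE monoE; case: ifP => _; last by rewrite eqxx.
by case: (eqVneq G F) => [-> _|]; [left|rewrite eqxx].
Qed.

Lemma first_missing F : (#|F| < n)%N ->
  exists m, [/\ (m < n)%N, v m \notin F & forall l, (l < m)%N -> v l \in F].
Proof.
move=> Fn.
have ex : exists l, (l < n)%N && (v l \notin F).
  have /set0Pn[i] : ~: F != finset.set0.
    by rewrite -card_gt0; have := cardsC F; rewrite card_ord; lia.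
  rewrite inE => iF; exists (n - i.+1)%N; rewrite top_vertexK iF andbT.
  by have := ltn_ord i; lia.
case: (ex_minnP ex) => m /andP[mn mF] mmin; exists m; split=> // l lm.
apply/negPn/negP => lF; have := mmin l; rewrite lF (ltn_trans lm mn) => /(_ isT).
by rewrite leqNgt lm.
Qed.

(** No standard set is larger than d; below size d, adding the largest missing vertex keeps a set
    standard by [initial_down]. *)
Lemma noninitial_extend F : ~ initial_set C phi F ->
  exists2 G : {set 'I_n}, F \subset G & #|G| = d /\ ~ initial_set C phi G.
Proof.
have dn : (d <= n)%N by case: C_dim => _ [G _ <-]; rewrite -[n in (_ <= n)%N]card_ord max_card.
move=> nF; have Fd : (#|F| <= d)%N by rewrite leqNgt; apply/negP => /initial_large.
move eqk : (d - #|F|)%N => k; elim: k F nF Fd eqk => [|k IH] F nF Fd eqk.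
  by exists F => //; split=> //; lia.
have [|m [mn mF Fm]] := @first_missing F; first by lia.
have [|||G FG Gd] := IH (v m |: F).
- by move=> iG; apply: nF; apply: (initial_down mn Fm mF) iG; lia.
- by rewrite cardsU1_notin //; lia.
- by rewrite cardsU1_notin //; lia.
by exists G => //; apply: subset_trans FG; apply: subsetUr.
Qed.

Lemma noninitial_cyclic F : #|F| = d -> ~ initial_set C phi F -> cyclic_facet d F.
Proof.
move=> Fd nF; split=> // k nk p kp.
have dn : (d <= n)%N by rewrite -Fd -[n in (_ <= n)%N]card_ord max_card.
(* The label [p] shows that the interval from n-d+k to n-k-1 is nonempty. *)
have kd : (k.*2 < d)%N by lia.
have kn : (k < n)%N by lia.
have kF : v k \notin F.
  apply/negP => kF; apply: nk; exists (v k) => //; rewrite top_vertexE //; lia.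
have dn' : (d < n)%N.
  rewrite -Fd -[n in (_ < n)%N]card_ord -cardsT; apply: proper_card.
  by apply/properP; split; [exact: subsetT|exists (v k); rewrite ?inE].
have [|m [mn mF Fm]] := @first_missing F; first by rewrite Fd.
have mk : (m <= k)%N by rewrite leqNgt; apply: contra kF => /Fm.
have inF l : (m < l)%N -> (l <= d - m)%N -> v l \in F.
  move=> ml lm; apply/negPn/negP => lF; apply: nF.
  by apply: (@initial_top m l) => //; lia.
(* If m < k, then k lies between m + 1 and d - m, so F would contain v_k. *)
have {mk} mk : m = k.
  apply/eqP; rewrite eqn_leq mk /= leqNgt; apply: contra kF => ?; apply: inF => //; lia.
(* The label p belongs to v_(n-p), and k < n - p <= d - k. *)
exists (v (absz (n%:Z - p))); first by apply: inF; rewrite mk; lia.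
by rewrite top_vertexE; lia.
Qed.

End Main.

Local Open Scope classical_set_scope.

Theorem theorem4p8 (K : fieldType) (n d : nat) (C : {set {set 'I_n}}) :
  infinite_set [set: K] ->
  simplicial_complex C ->
  dimS C = d ->
  strongly_edge_decomposable C ->
  exterior_shifting K C `<=` cyclic_shifting n d.
Proof.
move=> Kinf [closedC _] dimC sedC F nginF.
have dC : has_dim C d by rewrite -dimC; apply: has_dim_dimS; case: closedC.
have [reg cyc] := strongly_edge_decomposable_ranks Kinf sedC dC.
have [n0|n0] := posnP n.
  (* Without vertices there is no [x0]; then d = 0 and the empty set is the only set. *)
  have noI (i : 'I_n) : False by have := ltn_ord i; rewrite [X in (_ < X)%N]n0.
  have card0 (G : {set 'I_n}) : #|G| = 0%N.
    by apply: eq_card0 => i; case: (noI i).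
  have d0 : d = 0%N by case: dC => _ [G _ <-].
  exists F => //; split=> [|k _ m]; first by rewrite card0.
  by move=> mk; exfalso; lia.
(* Finitely many bounds, so that they hold together on a nonempty open set; [k < d.+1./2] means 2k <
   d. *)
pose P (f : nat -> 'I_n -> K) := (forall m, (m < n.+1)%N -> forall s, (s < d.+1)%N ->
    rho (cnt C) m s <= (forms_rank (layer C s) (iota 0 m) (iota 0 m) f)%:Z) /\
  (forall k, (k < d.+1./2)%N -> rho (cnt C) k d <=
    (forms_rank (layer C d) (iota 0 k.+1) (iota 0 k ++ iota k.+1 (d - k.*2)) f)%:Z).
have [oP exP] : generic (@form_curve K n) P.
  have f0 : nat -> 'I_n -> K := fun _ _ => 0.
  apply: (generic_and Kinf (@form_curve_join K n)).
    apply: (generic_all Kinf (@form_curve_join K n) f0) => m _.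
    apply: (generic_all Kinf (@form_curve_join K n) f0) => s sd.
    by apply: forms_rank_generic; apply: reg.
  apply: (generic_all Kinf (@form_curve_join K n) f0) => k kd.
  by apply: forms_rank_generic; apply: cyc; lia.
have [|phi [f [uphi ginE [Pf1 Pf2] fE]]] := gin_point Kinf closedC oP exP.
  move=> f c c0 [P1 P2]; split=> [m mn s sd|k kd].
    by apply: le_trans (P1 m mn s sd) _; rewrite lez_nat forms_rank_scale.
  by apply: le_trans (P2 k kd) _; rewrite lez_nat forms_rank_scale.
(* The initial ideal at this [phi] is the generic one, so faces of the shifted complex are standard
   sets. *)
have nF : ~ initial_set C phi F.
  move=> [u [Ju iu]]; apply: nginF; rewrite -ginE => I idI sub; apply: sub.
  by exists u, F.
pose x0 := Ordinal n0.
have reg_lower m s : (m <= n)%N -> (s <= d)%N ->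
    rho (cnt C) m s <= (regular_rank C f m s)%:Z by move=> mn sd; apply: Pf1.
have cyc_lower k : (k.*2 < d)%N -> rho (cnt C) k d <=
    (forms_rank (layer C d) (iota 0 k.+1) (iota 0 k ++ iota k.+1 (d - k.*2)) f)%:Z.
  by move=> kd; apply: Pf2; lia.
have [G FG [Gd nG]] := noninitial_extend closedC dC x0 uphi fE reg_lower nF.
exists G => //; exact: (noninitial_cyclic closedC x0 uphi fE reg_lower cyc_lower Gd nG).
Qed.
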